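(* Let $K\subset\mathbb{R}^n$ be a proper cone. (i) The discrete-time joint spectral radius $\mathcal{M}\mapsto\rho(\mathcal{S}(\mathcal{M},\mathbb{N}))$ is locally Lipschitz continuous on $\mathcal{P}_\mathbb{N}=\{\mathcal{M}\subset\pi(K):\mathcal{M}\text{ compact, nonempty, and }\operatorname{conv}\mathcal{M}\text{ contains a }K\text{-irreducible element}\}$ endowed with the Hausdorff metric. (ii) The continuous-time joint spectral radius $\mathcal{M}\mapsto\rho(\mathcal{S}(\mathcal{M},\mathbb{R}_+))$ is locally Lipschitz continuous on $\mathcal{P}_{\mathbb{R}_+}=\{\mathcal{M}\subset\pi_{\exp}(K):\mathcal{M}\text{ compact, nonempty, and }\mathcal{S}(\mathcal{M},\mathbb{R}_+)\text{ is }K\text{-irreducible}\}$ endowed with the Hausdorff metric.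
   Context: A proper cone $K\subset\mathbb{R}^n$ is a nonempty set with $rK\subset K$ for all $r>0$ which is convex, pointed, closed and has nonempty interior. Write $x\ge_K y$ if $x-y\in K$. A face of $K$ is a cone $F\subseteq K$ with: $x\in F$, $x\ge_K y\ge_K0$ imply $y\in F$; $\{0\},K$ are trivial. $\pi(K)=\{A: AK\subset K\}$, $\pi_{\exp}(K)=\{A:e^{At}K\subset K\ \forall t\ge0\}$; $A\in\pi(K)$ is $K$-irreducible if no nontrivial face $F$ has $AF\subset F$. Discrete semigroup $\mathcal{S}(\mathcal{M},\mathbb{N})=\bigcup_{t\in\mathbb{N}}\mathcal{S}_t$, $\mathcal{S}_0=\{I\}$, $\mathcal{S}_t=\{A_{t-1}\cdots A_0:A_s\in\mathcal{M}\}$. Continuous semigroup $\mathcal{S}(\mathcal{M},\mathbb{R}_+)=\bigcup_{t\ge0}\mathcal{S}_t$, $\mathcal{S}_t=\{\Phi_\sigma(t):\sigma:[0,t]\to\mathcal{M}\text{ measurable}\}$, $\dot\Phi_\sigma=\sigma\Phi_\sigma$, $\Phi_\sigma(0)=I$. A semigroup $\mathcal{S}\subset\pi(K)$ is $K$-irreducible if for some $t>0$, $\operatorname{conv}\mathcal{S}_t$ contains a $K$-irreducible element. Joint spectral radius $\rho(\mathcal{S})=\lim_{t\to\infty}\sup\{\|S\|:S\in\mathcal{S}_t\}^{1/t}$. Hausdorff metric $H(\mathcal{M},\mathcal{N})=\max\{\max_{A\in\mathcal{M}}\min_{B\in\mathcal{N}}\|A-B\|,\max_{B\in\mathcal{N}}\min_{A\in\mathcal{M}}\|A-B\|\}$.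 Locally Lipschitz: every point has a neighbourhood on which the map is Lipschitz. *)

(* Defs.v *)
From Stdlib Require Import Reals ClassicalEpsilon Factorial.
From mathcomp Require Import ssreflect ssrfun ssrbool eqtype ssrnat seq fintype bigop.
Set Implicit Arguments. Unset Strict Implicit. Unset Printing Implicit Defensive.
Open Scope R_scope.

Definition vec (n : nat) := 'I_n -> R.
Definition mat (n : nat) := 'I_n -> 'I_n -> R.

Definition vzero n : vec n := fun _ => 0.
Definition vadd n (x y : vec n) : vec n := fun i => x i + y i.
Definition vopp n (x : vec n) : vec n := fun i => - x i.
Definition vscale n (r : R) (x : vec n) : vec n := fun i => r * x i.
Definition vnorm n (x : vec n) : R := \big[Rmax/0]_(i < n) Rabs (x i).

Definition mzero n : mat n := fun _ _ => 0.
Definition mid n : mat n := fun i j => if i == j then 1 else 0.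
Definition madd n (A B : mat n) : mat n := fun i j => A i j + B i j.
Definition mopp n (A : mat n) : mat n := fun i j => - A i j.
Definition mscale n (r : R) (A : mat n) : mat n := fun i j => r * A i j.
Definition mmul n (A B : mat n) : mat n :=
  fun i j => \big[Rplus/0]_(k < n) (A i k * B k j).
Definition mapply n (A : mat n) (x : vec n) : vec n :=
  fun i => \big[Rplus/0]_(k < n) (A i k * x k).
(* a matrix norm (max-entry norm; all norms are equivalent) *)
Definition mnorm n (A : mat n) : R :=
  \big[Rmax/0]_(i < n) \big[Rmax/0]_(j < n) Rabs (A i j).
Definition mdist n (A B : mat n) : R := mnorm (madd A (mopp B)).

Fixpoint mpow n (A : mat n) (k : nat) : mat n :=
  match k with O => @mid n | S k' => mmul A (mpow A k') end.
Definition mexp n (A : mat n) : mat n := fun i j =>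
  epsilon (inhabits 0)
    (fun l => Un_cv (fun N => sum_f_R0 (fun k => mpow A k i j / INR (fact k)) N) l).

Definition Rsup (E : R -> Prop) : R := epsilon (inhabits 0) (fun l => is_lub E l).
Definition Rinf (E : R -> Prop) : R := - Rsup (fun x => E (- x)).

Definition is_cone n (K : vec n -> Prop) : Prop :=
  (exists x, K x) /\ (forall r x, 0 < r -> K x -> K (vscale r x)).
Definition convex_set n (K : vec n -> Prop) : Prop :=
  forall x y t, K x -> K y -> 0 <= t <= 1 ->
    K (vadd (vscale t x) (vscale (1 - t) y)).
Definition pointed n (K : vec n -> Prop) : Prop :=
  forall x, K x -> K (vopp x) -> x = @vzero n.
Definition closed_set n (K : vec n -> Prop) : Prop :=
  forall x, (forall eps, 0 < eps -> exists y, K y /\ vnorm (vadd x (vopp y)) < eps) -> K x.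
Definition nonempty_interior n (K : vec n -> Prop) : Prop :=
  exists x eps, 0 < eps /\ forall y, vnorm (vadd y (vopp x)) < eps -> K y.
Definition proper_cone n (K : vec n -> Prop) : Prop :=
  is_cone K /\ convex_set K /\ pointed K /\ closed_set K /\ nonempty_interior K.

Definition Kge n (K : vec n -> Prop) (x y : vec n) : Prop := K (vadd x (vopp y)).

Definition is_face n (K F : vec n -> Prop) : Prop :=
  is_cone F /\ convex_set F /\ (forall x, F x -> K x) /\
  (forall x y, F x -> Kge K x y -> Kge K y (@vzero n) -> F y).
Definition nontrivial_face n (K F : vec n -> Prop) : Prop :=
  is_face K F /\ (exists x, F x /\ x <> @vzero n) /\ (exists x, K x /\ ~ F x).

Definition in_pi n (K : vec n -> Prop) (A : mat n) : Prop :=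
  forall x, K x -> K (mapply A x).
Definition in_pi_exp n (K : vec n -> Prop) (A : mat n) : Prop :=
  forall t, 0 <= t -> in_pi K (mexp (mscale t A)).
Definition K_irreducible n (K : vec n -> Prop) (A : mat n) : Prop :=
  in_pi K A /\
  ~ (exists F, nontrivial_face K F /\ forall x, F x -> F (mapply A x)).

Fixpoint mcomb n (l : seq (R * mat n)) : mat n :=
  match l with nil => @mzero n | (c, A) :: l' => madd (mscale c A) (mcomb l') end.
Fixpoint wsum n (l : seq (R * mat n)) : R :=
  match l with nil => 0 | (c, _) :: l' => c + wsum l' end.
Definition mconv n (M : mat n -> Prop) : mat n -> Prop := fun B =>
  exists l : seq (R * mat n),
    (forall p, List.In p l -> 0 <= fst p /\ M (snd p)) /\ wsum l = 1 /\ B = mcomb l.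
Definition mcompact n (M : mat n -> Prop) : Prop :=
  (exists C, forall A, M A -> mnorm A <= C) /\
  (forall A, (forall eps, 0 < eps -> exists B, M B /\ mdist A B < eps) -> M A).
Definition hausdorff n (M N : mat n -> Prop) : R :=
  Rmax (Rsup (fun r => exists A, M A /\ r = Rinf (fun s => exists B, N B /\ s = mdist A B)))
       (Rsup (fun r => exists B, N B /\ r = Rinf (fun s => exists A, M A /\ s = mdist A B))).

Fixpoint disc_St n (M : mat n -> Prop) (t : nat) : mat n -> Prop :=
  match t with
  | O => fun B => B = @mid n
  | S t' => fun B => exists A P, M A /\ disc_St M t' P /\ B = mmul A P
  end.

Definition null_set (E : R -> Prop) : Prop :=
  forall eps, 0 < eps -> exists a b : nat -> R,
    (forall x, E x -> exists k, a k < x < b k) /\ (forall k, a k <= b k) /\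
    (forall N, sum_f_R0 (fun k => b k - a k) N <= eps).
Definition abs_cont_on n (Phi : R -> mat n) (t : R) : Prop :=
  forall eps, 0 < eps -> exists delta, 0 < delta /\
    forall (m : nat) (a b : nat -> R),
      (forall k, (k < m)%nat -> 0 <= a k /\ a k <= b k /\ b k <= t) ->
      (forall k, (k.+1 < m)%nat -> b k <= a k.+1) ->
      \big[Rplus/0]_(k < m) (b k - a k) < delta ->
      \big[Rplus/0]_(k < m) mdist (Phi (b k)) (Phi (a k)) < eps.
Definition mderiv_at n (Phi : R -> mat n) (s : R) (D : mat n) : Prop :=
  forall i j, derivable_pt_lim (fun u => Phi u i j) s (D i j).
(* continuous: S_t = { Phi_sigma(t) : sigma : [0,t] -> M }, Phi_sigma the
   (Caratheodory) solution of dPhi/ds = sigma(s) Phi(s), Phi(0) = I *)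
Definition cont_St n (M : mat n -> Prop) (t : R) : mat n -> Prop := fun B =>
  exists sigma Phi : R -> mat n,
    (forall s, 0 <= s <= t -> M (sigma s)) /\
    Phi 0 = @mid n /\ abs_cont_on Phi t /\
    null_set (fun s => 0 < s < t /\ ~ mderiv_at Phi s (mmul (sigma s) (Phi s))) /\
    B = Phi t.

Definition root_t (x t : R) : R := if Rlt_dec 0 x then Rpower x (/ t) else 0.
Definition sup_norm n (S : mat n -> Prop) : R :=
  Rsup (fun r => exists A, S A /\ r = mnorm A).
Definition jsr_disc n (M : mat n -> Prop) : R :=
  epsilon (inhabits 0)
    (fun r => Un_cv (fun t => root_t (sup_norm (disc_St M t)) (INR t)) r).
Definition jsr_cont n (M : mat n -> Prop) : R :=
  epsilon (inhabits 0)
    (fun r => forall eps, 0 < eps -> exists T, forall t, T <= t ->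
       Rabs (root_t (sup_norm (cont_St M t)) t - r) < eps).

Definition P_disc n (K : vec n -> Prop) (M : mat n -> Prop) : Prop :=
  (forall A, M A -> in_pi K A) /\ mcompact M /\ (exists A, M A) /\
  (exists B, mconv M B /\ K_irreducible K B).
Definition P_cont n (K : vec n -> Prop) (M : mat n -> Prop) : Prop :=
  (forall A, M A -> in_pi_exp K A) /\ mcompact M /\ (exists A, M A) /\
  (exists t, 0 < t /\ exists B, mconv (cont_St M t) B /\ K_irreducible K B).

Definition loc_lipschitz n (P : (mat n -> Prop) -> Prop) (f : (mat n -> Prop) -> R) : Prop :=
  forall M, P M -> exists delta L, 0 < delta /\ 0 <= L /\
    forall N1 N2, P N1 -> P N2 -> hausdorff M N1 < delta -> hausdorff M N2 < delta ->
      Rabs (f N1 - f N2) <= L * hausdorff N1 N2.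

(* Main.v *)
(** The growth of a positive semigroup is uniform near an irreducible one.  If [B] is
    [K]-irreducible, then [I + B + ... + B^m] maps every unit vector of [K] above
    [c e], with [e] an order unit, and this persists with [c / 2] for [B'] near [B].
    Hence for positive [S], [T] of lengths [s], [t] the vector [S (I + ... + B'^m) T e]
    dominates a multiple of [|T e| S e], so that for any growth rate [r] the number
    [beta = sup |X e| / r^t] satisfies [beta^2 <= C beta]: a bound [|X| <= G r^t] holds
    with [G] independent of the set of matrices near the given one.  Expanding products
    of perturbed matrices then yields [rho(N1) <= rho(N2) + n^2 G h].

    In continuous time, a gauge-integral argument shows that every Caratheodory
    solution is a limit of products of exponentials [exp(h_k A_k)] with [A_k] in [M].
    The time-[t0] products form a set of positive matrices depending in a Lipschitz
    way on [M], to which the discrete case applies; the continuous radius is the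
    [1/t0]-th power of the discrete one, which is bounded away from [0]. *)

From HB Require Import structures.
Require Import Defs.
From Stdlib Require Import Reals.
From Stdlib Require Import Lra Lia Classical ClassicalEpsilon Factorial.
From Stdlib Require Import FunctionalExtensionality PropExtensionality.
From Coquelicot Require Import Coquelicot.
From mathcomp Require Import ssreflect ssrfun ssrbool eqtype ssrnat seq fintype bigop.
From mathcomp Require Import zify.
Set Implicit Arguments. Unset Strict Implicit. Unset Printing Implicit Defensive.
Open Scope R_scope.

(** * Sums, vectors and matrices *)

(** For a single set every rate [r] above the radius admits a bound [C * r ^ t], but [C] may blow up
    when [r] decreases to the radius or the set varies. This is what destroys Lipschitz continuity
    at reducible sets: the matrix with rows [(1, 1)] and [(eps, 1)] has spectral radius
    [1 + sqrt eps]. The constant must therefore be uniform in both respects, and the perturbation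
    estimate must charge it to the rate rather than to the product.

    The radius is handled as [is_rate], an infimum of admissible rates, so that comparing two radii
    means deducing one bound from another; limits enter only when [is_rate] is identified with the
    radii of the statement. The comparison is one-sided: positivity and closeness to the given set
    are asked of [N2] only, and exchanging the two sets gives the absolute value.

    In continuous time no integral of [sigma] is formed. The differential equation is used pointwise
    at the tags of a partition, and absolute continuity pays for the tags in the null set. *)

HB.instance Definition _ := Monoid.isComLaw.Build R 0 Rplus
  (fun x y z => esym (Rplus_assoc x y z)) Rplus_comm Rplus_0_l.
HB.instance Definition _ := Monoid.isMulLaw.Build R 0 Rmult Rmult_0_l Rmult_0_r.
HB.instance Definition _ := Monoid.isAddLaw.Build R Rmult Rplus
  Rmult_plus_distr_r (fun x y z => Rmult_plus_distr_l x y z).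

Local Notation "\rsum_ ( i < n ) F" := (\big[Rplus/0]_(i < n) F)
  (at level 41, F at level 41, i, n at level 50).

Lemma rsum_le n (F G : 'I_n -> R) :
  (forall i, F i <= G i) -> \rsum_(i < n) F i <= \rsum_(i < n) G i.
Proof.
move=> FG; elim/big_ind2: _ => [|x1 x2 y1 y2 ? ?|i _]; [lra|lra|exact: FG].
Qed.

Lemma rsum_const n (c : R) : \rsum_(i < n) c = INR n * c.
Proof.
elim: n => [|n IH]; first by rewrite big_ord0 /=; lra.
by rewrite big_ord_recr IH S_INR /=; lra.
Qed.

Lemma rsum_abs n (F : 'I_n -> R) :
  Rabs (\rsum_(i < n) F i) <= \rsum_(i < n) Rabs (F i).
Proof.
elim/big_ind2: _ => [|x1 x2 y1 y2 ? ?|i _]; [rewrite Rabs_R0; lra| |lra].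
apply: Rle_trans (Rabs_triang _ _) _; lra.
Qed.

Lemma rsum_scale n (c : R) (F : 'I_n -> R) :
  c * (\rsum_(i < n) F i) = \rsum_(i < n) (c * F i).
Proof. by rewrite big_distrr. Qed.

Lemma rsum_delta n (i : 'I_n) (F : 'I_n -> R) :
  \rsum_(k < n) ((if i == k then 1 else 0) * F k) = F i.
Proof.
rewrite (bigD1 i) //= eqxx big1 ?Rplus_0_r ?Rmult_1_l // => k.
by rewrite eq_sym => /negbTE ->; rewrite Rmult_0_l.
Qed.

Lemma bigmax_ge (I : finType) (F : I -> R) i : F i <= \big[Rmax/0]_j F j.
Proof.
have : i \in index_enum I by rewrite mem_index_enum.
elim: (index_enum I) => // j s IH; rewrite inE big_cons => /orP[/eqP->|/IH].
  exact: Rmax_l.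
by move=> h; apply: Rle_trans h (Rmax_r _ _).
Qed.

Lemma bigmax_ge0 (I : finType) (F : I -> R) : 0 <= \big[Rmax/0]_j F j.
Proof.
elim: (index_enum I) => [|j s IH]; rewrite ?big_nil ?big_cons; first lra.
by apply: Rle_trans IH (Rmax_r _ _).
Qed.

Lemma bigmax_le (I : finType) (F : I -> R) c :
  0 <= c -> (forall i, F i <= c) -> \big[Rmax/0]_j F j <= c.
Proof. by move=> c0 Fc; elim/big_ind: _ => // x y; exact: Rmax_lub. Qed.

Section VectorNorm.
Variable n : nat.
Implicit Types (x y z : vec n).

Lemma vnorm_ge0 x : 0 <= vnorm x. Proof. exact: bigmax_ge0. Qed.

Lemma vnorm_coord x i : Rabs (x i) <= vnorm x.
Proof. exact: (bigmax_ge (fun i => Rabs (x i))). Qed.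

Lemma vnorm_le x c : 0 <= c -> (forall i, Rabs (x i) <= c) -> vnorm x <= c.
Proof. exact: bigmax_le. Qed.

Lemma vnorm_add x y : vnorm (vadd x y) <= vnorm x + vnorm y.
Proof.
apply: vnorm_le => [|i]; first by have := vnorm_ge0 x; have := vnorm_ge0 y; lra.
apply: Rle_trans (Rabs_triang _ _) _.
by have := vnorm_coord x i; have := vnorm_coord y i; lra.
Qed.

Lemma vnorm_scale_le c x : vnorm (vscale c x) <= Rabs c * vnorm x.
Proof.
apply: vnorm_le => [|i].
  by apply: Rmult_le_pos; [exact: Rabs_pos|exact: vnorm_ge0].
rewrite /vscale Rabs_mult; apply: Rmult_le_compat_l; first exact: Rabs_pos.
exact: vnorm_coord.
Qed.

Lemma vnorm_scale c x : 0 <= c -> vnorm (vscale c x) = c * vnorm x.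
Proof.
move=> c0; have := vnorm_scale_le c x; rewrite (Rabs_pos_eq c) // => h.
apply: Rle_antisym => //; case: (Req_dec c 0) => [->|cn0].
  by rewrite Rmult_0_l; exact: vnorm_ge0.
have c_gt0 : 0 < c by lra.
have := vnorm_scale_le (/ c) (vscale c x).
rewrite Rabs_pos_eq; last by apply: Rlt_le; exact: Rinv_0_lt_compat.
have -> : vscale (/ c) (vscale c x) = x.
  by apply: functional_extensionality => i; rewrite /vscale; field.
move=> /(Rmult_le_compat_l c _ _ c0); rewrite -Rmult_assoc Rinv_r ?Rmult_1_l //.
Qed.

Lemma vnorm_opp x : vnorm (vopp x) = vnorm x.
Proof. by apply: eq_bigr => i _; rewrite Rabs_Ropp. Qed.

Lemma vnorm_eq0 x : vnorm x = 0 -> x = @vzero n.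
Proof.
move=> x0; apply: functional_extensionality => i; have := vnorm_coord x i.
rewrite x0 /vzero => h; have := Rabs_pos (x i) => h'.
by case: (Req_dec (x i) 0) => // /Rabs_no_R0; lra.
Qed.

Lemma vnorm_zero : vnorm (@vzero n) = 0.
Proof.
apply: Rle_antisym; last exact: vnorm_ge0.
by apply: vnorm_le => [|i]; rewrite ?Rabs_R0; lra.
Qed.

End VectorNorm.

Section MatrixAlgebra.
Variable n : nat.
Implicit Types (A B X Y : mat n) (x y : vec n).

Lemma mat_ext A B : (forall i j, A i j = B i j) -> A = B.
Proof.
by move=> h; apply: functional_extensionality => i; apply: functional_extensionality.
Qed.

Lemma vec_ext x y : (forall i, x i = y i) -> x = y.
Proof. exact: functional_extensionality. Qed.

Lemma mmulA A B X : mmul A (mmul B X) = mmul (mmul A B) X.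
Proof.
apply: mat_ext => i j; rewrite /mmul.
under eq_bigr => k _ do rewrite rsum_scale.
rewrite exchange_big /=; apply: eq_bigr => l _.
by rewrite Rmult_comm rsum_scale; apply: eq_bigr => k _; ring.
Qed.

Lemma mmulDl A B X : mmul (madd A B) X = madd (mmul A X) (mmul B X).
Proof.
apply: mat_ext => i j; rewrite /mmul /madd -big_split.
by apply: eq_bigr => k _ /=; ring.
Qed.

Lemma mmulDr A B X : mmul X (madd A B) = madd (mmul X A) (mmul X B).
Proof.
apply: mat_ext => i j; rewrite /mmul /madd -big_split.
by apply: eq_bigr => k _ /=; ring.
Qed.

Lemma mmulZl c A X : mmul (mscale c A) X = mscale c (mmul A X).
Proof.
apply: mat_ext => i j; rewrite /mmul /mscale rsum_scale.
by apply: eq_bigr => k _ /=; ring.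
Qed.

Lemma mmulZr c A X : mmul X (mscale c A) = mscale c (mmul X A).
Proof.
apply: mat_ext => i j; rewrite /mmul /mscale rsum_scale.
by apply: eq_bigr => k _ /=; ring.
Qed.

Lemma mmul1l A : mmul (@mid n) A = A.
Proof. by apply: mat_ext => i j; rewrite /mmul /mid rsum_delta. Qed.

Lemma mmul1r A : mmul A (@mid n) = A.
Proof.
apply: mat_ext => i j; rewrite /mmul /mid -[RHS](rsum_delta j (fun k => A i k)).
by apply: eq_bigr => k _; rewrite eq_sym; ring.
Qed.

Lemma mmul0r A : mmul A (@mzero n) = @mzero n.
Proof. by apply: mat_ext => i j; rewrite /mmul /mzero big1 // => k _; ring. Qed.

Lemma moppE A : mopp A = mscale (-1) A.
Proof. by apply: mat_ext => i j; rewrite /mopp /mscale; ring. Qed.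

Lemma mmulBl A B X : mmul (madd A (mopp B)) X = madd (mmul A X) (mopp (mmul B X)).
Proof. by rewrite !moppE mmulDl mmulZl. Qed.

Lemma mmulBr A B X : mmul X (madd A (mopp B)) = madd (mmul X A) (mopp (mmul X B)).
Proof. by rewrite !moppE mmulDr mmulZr. Qed.

Lemma mpowSr A k : mpow A k.+1 = mmul (mpow A k) A.
Proof.
elim: k => [|k IH]; first by rewrite /= mmul1l mmul1r.
by rewrite [LHS]/= -/(mpow A k.+1) {1}IH /= mmulA.
Qed.

Lemma mapply_mul A B x : mapply (mmul A B) x = mapply A (mapply B x).
Proof.
apply: vec_ext => i; rewrite /mapply /mmul.
under [RHS]eq_bigr => k _ do rewrite rsum_scale.
rewrite [RHS]exchange_big /=; apply: eq_bigr => l _.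
by rewrite Rmult_comm rsum_scale; apply: eq_bigr => k _; ring.
Qed.

Lemma mapply_id x : mapply (@mid n) x = x.
Proof. by apply: vec_ext => i; rewrite /mapply /mid rsum_delta. Qed.

Lemma mapplyDl A B x : mapply (madd A B) x = vadd (mapply A x) (mapply B x).
Proof.
apply: vec_ext => i; rewrite /mapply /madd /vadd -big_split.
by apply: eq_bigr => k _ /=; ring.
Qed.

Lemma mapplyDr A x y : mapply A (vadd x y) = vadd (mapply A x) (mapply A y).
Proof.
apply: vec_ext => i; rewrite /mapply /vadd -big_split.
by apply: eq_bigr => k _ /=; ring.
Qed.

Lemma mapplyZl c A x : mapply (mscale c A) x = vscale c (mapply A x).
Proof.
apply: vec_ext => i; rewrite /mapply /mscale /vscale rsum_scale.
by apply: eq_bigr => k _ /=; ring.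
Qed.

Lemma mapplyZr c A x : mapply A (vscale c x) = vscale c (mapply A x).
Proof.
apply: vec_ext => i; rewrite /mapply /vscale rsum_scale.
by apply: eq_bigr => k _ /=; ring.
Qed.

Lemma voppE x : vopp x = vscale (-1) x.
Proof. by apply: vec_ext => i; rewrite /vopp /vscale; ring. Qed.

Lemma mapplyNl A x : mapply (mopp A) x = vopp (mapply A x).
Proof. by rewrite moppE mapplyZl voppE. Qed.

Lemma mapplyNr A x : mapply A (vopp x) = vopp (mapply A x).
Proof. by rewrite !voppE mapplyZr. Qed.

Lemma mapply0 A : mapply A (@vzero n) = @vzero n.
Proof. by apply: vec_ext => i; rewrite /mapply /vzero big1 // => k _; ring. Qed.

Lemma mapply_mzero x : mapply (@mzero n) x = @vzero n.
Proof. by apply: vec_ext => i; rewrite /mapply /mzero big1 // => k _; ring. Qed.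

Lemma mnorm_ge0 A : 0 <= mnorm A. Proof. exact: bigmax_ge0. Qed.

Lemma mnorm_entry A i j : Rabs (A i j) <= mnorm A.
Proof.
apply: Rle_trans (bigmax_ge (fun i => \big[Rmax/0]_(j < n) Rabs (A i j)) i).
exact: (bigmax_ge (fun j => Rabs (A i j))).
Qed.

Lemma mnorm_le A c : 0 <= c -> (forall i j, Rabs (A i j) <= c) -> mnorm A <= c.
Proof. by move=> c0 h; apply: bigmax_le => // i; exact: bigmax_le. Qed.

Lemma mnorm_add A B : mnorm (madd A B) <= mnorm A + mnorm B.
Proof.
apply: mnorm_le => [|i j]; first by have := mnorm_ge0 A; have := mnorm_ge0 B; lra.
apply: Rle_trans (Rabs_triang _ _) _.
by have := mnorm_entry A i j; have := mnorm_entry B i j; lra.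
Qed.

Lemma mnorm_opp A : mnorm (mopp A) = mnorm A.
Proof. by apply: eq_bigr => i _; apply: eq_bigr => j _; rewrite Rabs_Ropp. Qed.

Lemma mnorm_scale_le c A : mnorm (mscale c A) <= Rabs c * mnorm A.
Proof.
apply: mnorm_le => [|i j].
  by apply: Rmult_le_pos; [exact: Rabs_pos|exact: mnorm_ge0].
rewrite /mscale Rabs_mult; apply: Rmult_le_compat_l; first exact: Rabs_pos.
exact: mnorm_entry.
Qed.

Lemma mnorm_mul A B : mnorm (mmul A B) <= INR n * mnorm A * mnorm B.
Proof.
have An := mnorm_ge0 A; have Bn := mnorm_ge0 B.
apply: mnorm_le => [|i j]; first by do 2 apply: Rmult_le_pos => //; exact: pos_INR.
apply: Rle_trans (rsum_abs _) _; rewrite Rmult_assoc -rsum_const.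
apply: rsum_le => k; rewrite Rabs_mult.
by apply: Rmult_le_compat; try exact: Rabs_pos; exact: mnorm_entry.
Qed.

Lemma vnorm_mapply A x : vnorm (mapply A x) <= INR n * mnorm A * vnorm x.
Proof.
have An := mnorm_ge0 A; have xn := vnorm_ge0 x.
apply: vnorm_le => [|i]; first by do 2 apply: Rmult_le_pos => //; exact: pos_INR.
apply: Rle_trans (rsum_abs _) _; rewrite Rmult_assoc -rsum_const.
apply: rsum_le => k; rewrite Rabs_mult.
by apply: Rmult_le_compat; try exact: Rabs_pos; [exact: mnorm_entry|exact: vnorm_coord].
Qed.

Lemma mnorm_id_le1 : mnorm (@mid n) <= 1.
Proof.
by apply: mnorm_le => [|i j]; [lra|rewrite /mid; case: eqP => _; rewrite ?Rabs_R1 ?Rabs_R0; lra].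
Qed.

Lemma mdist_ge0 A B : 0 <= mdist A B. Proof. exact: mnorm_ge0. Qed.

Lemma mdistC A B : mdist A B = mdist B A.
Proof.
rewrite /mdist -mnorm_opp; congr mnorm.
by apply: mat_ext => i j; rewrite /madd /mopp; ring.
Qed.

Lemma mdist_triangle B A X : mdist A X <= mdist A B + mdist B X.
Proof.
rewrite /mdist; have -> : madd A (mopp X) = madd (madd A (mopp B)) (madd B (mopp X)).
  by apply: mat_ext => i j; rewrite /madd /mopp; ring.
exact: mnorm_add.
Qed.

Lemma mnorm_mdist A B : mnorm A <= mnorm B + mdist A B.
Proof.
rewrite {1}(_ : A = madd B (madd A (mopp B))); last first.
  by apply: mat_ext => i j; rewrite /madd /mopp; ring.
exact: mnorm_add.
Qed.

Lemma mdist_refl A : mdist A A = 0.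
Proof.
apply: Rle_antisym; last exact: mdist_ge0.
apply: mnorm_le => [|i j]; first lra.
by rewrite /madd /mopp Rplus_opp_r Rabs_R0; lra.
Qed.

End MatrixAlgebra.

(** * Compactness and proper cones *)

Ltac vring := apply: vec_ext => ?; rewrite /vadd /vopp /vscale /vzero; ring.
Ltac mring := apply: mat_ext => ? ?; rewrite /madd /mopp /mscale /mzero; ring.

Lemma increasing_le (phi : nat -> nat) :
  (forall k, (phi k < phi k.+1)%N) -> forall p q, (p <= q)%N -> (phi p <= phi q)%N.
Proof.
move=> inc p q; elim: q => [|q IH]; first by rewrite leqn0 => /eqP->.
rewrite leq_eqVlt => /orP[/eqP->//|]; rewrite ltnS => /IH h.
exact: leq_trans h (ltnW (inc q)).
Qed.

Lemma increasing_ge_id (phi : nat -> nat) :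
  (forall k, (phi k < phi k.+1)%N) -> forall p, (p <= phi p)%N.
Proof. by move=> inc; elim=> // p IH; apply: leq_ltn_trans IH (inc p). Qed.

Lemma Un_cv_sub (u : nat -> R) l (phi : nat -> nat) :
  (forall k, (phi k < phi k.+1)%N) -> Un_cv u l -> Un_cv (fun k => u (phi k)) l.
Proof.
move=> inc ul eps eps0; have [N hN] := ul _ eps0; exists N => k kN.
by apply: hN; have := increasing_ge_id inc k; lia.
Qed.

Lemma bounded_subseq (u : nat -> R) C : (forall k, Rabs (u k) <= C) ->
  exists phi l, (forall k, (phi k < phi k.+1)%N) /\ Un_cv (fun k => u (phi k)) l.
Proof.
move=> uC.
have ucomp k : - C <= u k <= C by have := uC k; rewrite /Rabs; case: Rcase_abs; lra.
have [l lP] := Bolzano_Weierstrass u _ (compact_P3 (- C) C) ucomp.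
(* Beyond any [p] some term is [1/(k+1)]-close to [l]; taking for [p] the previous index makes [phi]
   strictly increasing. *)
have pick p k : exists q, (p < q)%N /\ Rabs (u q - l) < / INR k.+1.
  have k0 : 0 < / INR k.+1 by apply: Rinv_0_lt_compat; apply: lt_0_INR; lia.
  have nb : neighbourhood (disc l (mkposreal _ k0)) l by exists (mkposreal _ k0).
  by have [q [pq uq]] := lP _ p.+1 nb; exists q; split; [lia|exact: uq].
pose f p k := proj1_sig (constructive_indefinite_description _ (pick p k)).
have fP p k : (p < f p k)%N /\ Rabs (u (f p k) - l) < / INR k.+1.
  exact: (proj2_sig (constructive_indefinite_description _ (pick p k))).
pose phi := fix phi k := if k is k'.+1 then f (phi k') k else f 0%N 0%N.
exists phi, l; split=> [k|eps eps0]; first exact: (fP _ _).1.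
have [N [N0 hN]] := archimed_cor1 eps eps0; exists N => k kN.
have : Rabs (u (phi k) - l) < / INR k.+1 by case: k {kN} => [|k]; exact: (fP _ _).2.
have : / INR k.+1 <= / INR N.
  by apply: Rinv_le_contravar; [apply: lt_0_INR|apply: le_INR]; lia.
rewrite /R_dist /Rdist; lra.
Qed.

(** Subsequences are extracted one coordinate at a time, along a list of coordinates. A cluster
    point is all that the compactness arguments on unit vectors of the cone use. *)
Lemma vec_bounded_cluster n (x : nat -> vec n) C : (forall k, vnorm (x k) <= C) ->
  exists l : vec n, forall eps p, 0 < eps ->
    exists q, (p <= q)%N /\ vnorm (vadd (x q) (vopp l)) < eps.
Proof.
move=> xC.
have sub (s : seq 'I_n) : exists phi (l : vec n), (forall k, (phi k < phi k.+1)%N) /\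
    forall i, i \in s -> Un_cv (fun k => x (phi k) i) (l i).
  elim: s => [|i s [phi [l [inc cv]]]]; first by exists id, (@vzero n).
  have [k|psi [li [inc' cv']]] := @bounded_subseq (fun k => x (phi k) i) C.
    exact: Rle_trans (vnorm_coord _ _) (xC _).
  exists (phi \o psi), (fun j => if j == i then li else l j); split.
    move=> k /=; apply: leq_trans (inc (psi k)) _; exact: increasing_le.
  move=> j; rewrite inE; case: eqP => [->|_] //= js.
  exact: (Un_cv_sub (u := fun k => x (phi k) j)) inc' (cv j js).
have [phi [l [inc cv]]] := sub (enum 'I_n).
exists l => eps p eps0.
have [N hN] : exists N, forall i k, (N <= k)%N -> Rabs (x (phi k) i - l i) < eps / 2.
  have h i : exists N, forall k, (N <= k)%N -> Rabs (x (phi k) i - l i) < eps / 2.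
    have ie : i \in enum 'I_n by rewrite mem_enum.
    have [|N hN] := cv i ie (eps / 2); first lra.
    by exists N => k Nk; apply: hN; lia.
  pose g i := proj1_sig (constructive_indefinite_description _ (h i)).
  exists (\max_(i < n) g i)%N => i k Nk.
  apply: (proj2_sig (constructive_indefinite_description _ (h i))).
  exact: leq_trans (leq_bigmax i) Nk.
exists (phi (maxn N p)); split.
  by apply: leq_trans (increasing_ge_id inc _); exact: leq_maxr.
apply: Rle_lt_trans (_ : eps / 2 < eps); last lra.
apply: vnorm_le => [|i]; first lra.
by apply: Rlt_le; apply: hN; exact: leq_maxl.
Qed.

(** * Proper cones and their order *)

Section Cone.
Variables (n : nat) (K : vec n -> Prop).
Hypothesis Kproper : proper_cone K.
Implicit Types (x y z e : vec n) (A B : mat n).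

Lemma cone_closed x :
  (forall eps, 0 < eps -> exists y, K y /\ vnorm (vadd x (vopp y)) < eps) -> K x.
Proof. by have [_ [_ [_ [+ _]]]] := Kproper; exact. Qed.

(** Scaling by [r > 0] alone does not give zero; closedness does, since small multiples of any point
    of [K] tend to it. *)
Lemma cone_zero : K (@vzero n).
Proof.
have [[[x Kx] Ks] _] := Kproper.
apply: cone_closed => eps eps0.
have x0 : 0 < vnorm x + 1 by have := vnorm_ge0 x; lra.
have c0 : 0 < eps / (vnorm x + 1) by exact: Rdiv_lt_0_compat.
exists (vscale (eps / (vnorm x + 1)) x); split; first exact: Ks.
have -> : vadd (@vzero n) (vopp (vscale (eps / (vnorm x + 1)) x)) =
  vopp (vscale (eps / (vnorm x + 1)) x) by vring.
rewrite vnorm_opp vnorm_scale; last lra.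
have h : eps = eps / (vnorm x + 1) * (vnorm x + 1) by field; lra.
rewrite {2}h; apply: Rmult_lt_compat_l; lra.
Qed.

Lemma cone_scale c x : 0 <= c -> K x -> K (vscale c x).
Proof.
move=> c0 Kx; case: (Req_dec c 0) => [->|cn0].
  by have -> : vscale 0 x = @vzero n; [vring|exact: cone_zero].
by have [[_ +] _] := Kproper; apply => //; lra.
Qed.

Lemma cone_add x y : K x -> K y -> K (vadd x y).
Proof.
move=> Kx Ky; have [_ [cvx _]] := Kproper.
have -> : vadd x y = vscale 2 (vadd (vscale (/ 2) x) (vscale (1 - / 2) y)).
  by apply: vec_ext => i; rewrite /vadd /vscale; field.
by apply: cone_scale; [lra|apply: cvx => //; lra].
Qed.

Lemma Kge_trans y x z : Kge K x y -> Kge K y z -> Kge K x z.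
Proof.
rewrite /Kge => xy yz; have -> : vadd x (vopp z) = vadd (vadd x (vopp y)) (vadd y (vopp z)).
  by vring.
exact: cone_add.
Qed.

Lemma Kge_refl x : Kge K x x.
Proof. by rewrite /Kge (_ : vadd x _ = @vzero n); [exact: cone_zero|vring]. Qed.

Lemma Kge_add x y x' y' : Kge K x y -> Kge K x' y' -> Kge K (vadd x x') (vadd y y').
Proof.
rewrite /Kge => h h'.
have -> : vadd (vadd x x') (vopp (vadd y y')) = vadd (vadd x (vopp y)) (vadd x' (vopp y')).
  by vring.
exact: cone_add.
Qed.

Lemma Kge_scale c x y : 0 <= c -> Kge K x y -> Kge K (vscale c x) (vscale c y).
Proof.
rewrite /Kge => c0 h.
have -> : vadd (vscale c x) (vopp (vscale c y)) = vscale c (vadd x (vopp y)) by vring.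
exact: cone_scale.
Qed.

Lemma Kge_scale_le c d x : K x -> c <= d -> Kge K (vscale d x) (vscale c x).
Proof.
rewrite /Kge => Kx cd.
have -> : vadd (vscale d x) (vopp (vscale c x)) = vscale (d - c) x by vring.
by apply: cone_scale => //; lra.
Qed.

Lemma Kge_mapply A x y : in_pi K A -> Kge K x y -> Kge K (mapply A x) (mapply A y).
Proof. by move=> KA /KA; rewrite mapplyDr mapplyNr. Qed.

(** The unit ball lies in the order interval from [-e] to [e]; the radius [c] makes the scaled
    version immediate. *)
Definition order_unit e := forall z c, vnorm z <= c -> K (vadd (vscale c e) z).

Lemma order_unit_exists : exists e, order_unit e.
Proof.
have [_ [_ [_ [_ [x [eps [eps0 hx]]]]]]] := Kproper.
(* An interior point, scaled so that a perturbation of norm [c] becomes one of norm at most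
   [eps / 2] at [x], strictly inside the ball. *)
exists (vscale (2 / eps) x) => z c zc.
have c0 : 0 <= c by have := vnorm_ge0 z; lra.
case: (Req_dec c 0) => [c00|cn0].
  have -> : z = @vzero n by apply: vnorm_eq0; have := vnorm_ge0 z; lra.
  rewrite c00 (_ : vadd _ _ = @vzero n); [exact: cone_zero|by vring].
have cpos : 0 < c by lra.
have -> : vadd (vscale c (vscale (2 / eps) x)) z =
    vscale (2 * c / eps) (vadd x (vscale (eps / (2 * c)) z)).
  by apply: vec_ext => i; rewrite /vadd /vscale; field; lra.
apply: cone_scale; first by apply: Rlt_le; apply: Rdiv_lt_0_compat; lra.
apply: hx; have -> : vadd (vadd x (vscale (eps / (2 * c)) z)) (vopp x) = vscale (eps / (2 * c)) z.
  by vring.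
have d0 : 0 < eps / (2 * c) by apply: Rdiv_lt_0_compat; lra.
rewrite vnorm_scale; last lra.
apply: Rle_lt_trans (_ : eps / (2 * c) * c < eps); first by apply: Rmult_le_compat_l; lra.
have -> : eps / (2 * c) * c = eps / 2 by field; lra.
lra.
Qed.

Lemma order_unit_cone e : order_unit e -> K e.
Proof.
move=> he; have := he (@vzero n) 1; rewrite vnorm_zero => h.
rewrite (_ : e = vadd (vscale 1 e) (@vzero n)); [apply: h; lra|by vring].
Qed.

Lemma order_unit_Kge e z c : order_unit e -> vnorm z <= c -> Kge K (vscale c e) z.
Proof. by move=> he zc; apply: he; rewrite vnorm_opp. Qed.

(** Normality of the cone. If it failed, unit vectors [x_k] of [K] would lie below [y_k] with [y_k]
    tending to [0]; a cluster point of the [x_k] and its opposite would both lie in the closed cone,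
    so pointedness would make it zero. *)
Lemma cone_normal : exists kappa, 0 < kappa /\
  forall x y, K x -> Kge K y x -> vnorm x <= kappa * vnorm y.
Proof.
apply: NNPP => nex.
have bad (k : nat) : exists xy : vec n * vec n,
    K xy.1 /\ Kge K xy.2 xy.1 /\ vnorm xy.1 = 1 /\ INR k.+1 * vnorm xy.2 < 1.
  apply: NNPP => nk; apply: nex; exists (INR k.+1); split; first by apply: lt_0_INR; lia.
  move=> x y Kx yx; apply: Rnot_lt_le => xy; apply: nk.
  have x0 : 0 < vnorm x.
    apply: Rle_lt_trans xy; apply: Rmult_le_pos; [exact: pos_INR|exact: vnorm_ge0].
  have c0 : 0 < / vnorm x by exact: Rinv_0_lt_compat.
  exists (vscale (/ vnorm x) x, vscale (/ vnorm x) y).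
  rewrite [fst _]/= [snd _]/=.
  split; first by apply: cone_scale => //; lra.
  split; first by apply: Kge_scale => //; lra.
  have c0' := Rlt_le _ _ c0; rewrite !vnorm_scale //; split; first by field; lra.
  have := Rmult_lt_compat_l _ _ _ c0 xy; rewrite Rinv_l; lra.
pose w k := proj1_sig (constructive_indefinite_description _ (bad k)).
have wP k : K (w k).1 /\ Kge K (w k).2 (w k).1 /\ vnorm (w k).1 = 1 /\
    INR k.+1 * vnorm (w k).2 < 1.
  exact: (proj2_sig (constructive_indefinite_description _ (bad k))).
have [k|l hl] := @vec_bounded_cluster n (fun k => (w k).1) 1.
  by have [_ [_ [-> _]]] := wP k; lra.
have Kl : K l.
  apply: cone_closed => eps /(hl _ 0%N)[q [_ hq]]; exists (w q).1.
  split; first by have [] := wP q.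
  rewrite -vnorm_opp; apply: Rle_lt_trans hq; apply: Req_le; congr vnorm; vring.
have Kln : K (vopp l).
  apply: cone_closed => eps eps0.
  have e2 : 0 < eps / 2 by lra.
  have [N [N0 hN]] := archimed_cor1 _ e2.
  have [q [qN hq]] := hl _ N e2; have [_ [Kd [_ h]]] := wP q.
  exists (vadd (w q).2 (vopp (w q).1)); split=> //.
  have -> : vadd (vopp l) (vopp (vadd (w q).2 (vopp (w q).1))) =
      vadd (vadd (w q).1 (vopp l)) (vopp (w q).2) by vring.
  apply: Rle_lt_trans (vnorm_add _ _) _; rewrite vnorm_opp.
  have q0 : 0 < INR q.+1 by apply: lt_0_INR; lia.
  have : vnorm (w q).2 <= / INR q.+1.
    apply: (Rmult_le_reg_l (INR q.+1)) => //; rewrite Rinv_r; lra.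
  have : / INR q.+1 <= / INR N.
    by apply: Rinv_le_contravar; [apply: lt_0_INR|apply: le_INR]; lia.
  lra.
have [_ [_ [pt _]]] := Kproper.
have l0 := pt l Kl Kln.
have [|q [_ hq]] := hl (1 / 2) 0%N; first lra.
have [_ [_ [h _]]] := wP q.
have e1 : vadd (w q).1 (vopp l) = (w q).1 by rewrite l0; vring.
rewrite e1 in hq; lra.
Qed.

End Cone.

(** * Irreducible matrices *)

(** An unweighted substitute for [(I + A)^m], the matrix whose positivity detects irreducibility in
    Perron-Frobenius theory. *)
Fixpoint psum n (A : mat n) (m : nat) : mat n :=
  if m is m'.+1 then madd (psum A m') (mpow A m) else @mid n.

Lemma psumSr n (A : mat n) m : psum A m.+1 = madd (psum A m) (mpow A m.+1).
Proof. by []. Qed.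

Lemma psumSl n (A : mat n) m : psum A m.+1 = madd (@mid n) (mmul A (psum A m)).
Proof.
elim: m => [//|m IH]; rewrite psumSr {1}IH psumSr mmulDr.
rewrite -/(mpow A m.+2); mring.
Qed.

Lemma mpow_cont n (A : mat n) k eps : 0 < eps ->
  exists delta, 0 < delta /\ forall B, mdist A B < delta -> mdist (mpow A k) (mpow B k) < eps.
Proof.
elim: k eps => [|k IH] eps eps0.
  by exists 1; split=> [|B _]; [lra|rewrite mdist_refl].
have n0 := pos_INR n; have A0 := mnorm_ge0 A; have P0 := mnorm_ge0 (mpow A k).
have nA : 0 <= INR n * mnorm A by exact: Rmult_le_pos.
have nP : 0 <= INR n * (mnorm (mpow A k) + 1) by apply: Rmult_le_pos; lra.
(* The [1] serves to bound [mpow B k] by [mnorm (mpow A k) + 1]. *)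
have [|d1 [d10 h1]] := IH (Rmin 1 (eps / (2 * (INR n * mnorm A + 1)))).
  by apply: Rmin_pos; [lra|apply: Rdiv_lt_0_compat; lra].
exists (Rmin d1 (eps / (2 * (INR n * (mnorm (mpow A k) + 1) + 1)))).
split; first by apply: Rmin_pos => //; apply: Rdiv_lt_0_compat; lra.
move=> B hB; have {h1}h1 := h1 B (Rlt_le_trans _ _ _ hB (Rmin_l _ _)).
have {hB}hB := Rlt_le_trans _ _ _ hB (Rmin_r _ _).
have h1a := Rlt_le_trans _ _ _ h1 (Rmin_l _ _).
have h1b := Rlt_le_trans _ _ _ h1 (Rmin_r _ _).
have -> : mdist (mpow A k.+1) (mpow B k.+1) = mnorm
    (madd (mmul A (madd (mpow A k) (mopp (mpow B k)))) (mmul (madd A (mopp B)) (mpow B k))).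
  by rewrite /mdist mmulBr mmulBl /=; congr mnorm; mring.
apply: Rle_lt_trans (mnorm_add _ _) _.
have hl : mnorm (mmul A (madd (mpow A k) (mopp (mpow B k)))) <=
  INR n * mnorm A * mdist (mpow A k) (mpow B k) := mnorm_mul _ _.
have hr : mnorm (mmul (madd A (mopp B)) (mpow B k)) <=
  INR n * mdist A B * mnorm (mpow B k) := mnorm_mul _ _.
have pB : mnorm (mpow B k) <= mnorm (mpow A k) + 1.
  by have := mnorm_mdist (mpow B k) (mpow A k); rewrite mdistC; lra.
have d0 := mdist_ge0 A B; have d0' := mdist_ge0 (mpow A k) (mpow B k).
have b1 : INR n * mnorm A * mdist (mpow A k) (mpow B k) <= eps / 2.
  apply: Rle_trans (_ : (INR n * mnorm A + 1) * (eps / (2 * (INR n * mnorm A + 1))) <= _).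
    by apply: Rmult_le_compat; lra.
  by apply: Req_le; field; lra.
have b2 : mdist A B * (INR n * (mnorm (mpow A k) + 1) + 1) < eps / 2.
  have -> : eps / 2 = eps / (2 * (INR n * (mnorm (mpow A k) + 1) + 1)) *
     (INR n * (mnorm (mpow A k) + 1) + 1) by field; lra.
  by apply: Rmult_lt_compat_r; lra.
have b3 : INR n * mdist A B * mnorm (mpow B k) <=
    mdist A B * (INR n * (mnorm (mpow A k) + 1) + 1).
  rewrite (Rmult_comm (INR n)) Rmult_assoc; apply: Rmult_le_compat_l => //.
  apply: Rle_trans (_ : INR n * (mnorm (mpow A k) + 1) <= _); last lra.
  exact: Rmult_le_compat_l.
lra.
Qed.

Lemma psum_cont n (A : mat n) m eps : 0 < eps ->
  exists delta, 0 < delta /\ forall B, mdist A B < delta -> mdist (psum A m) (psum B m) < eps.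
Proof.
elim: m eps => [|m IH] eps eps0.
  by exists 1; split=> [|B _]; [lra|rewrite mdist_refl].
have e2 : 0 < eps / 2 by lra.
have [d1 [d10 h1]] := IH _ e2; have [d2 [d20 h2]] := mpow_cont A m.+1 e2.
exists (Rmin d1 d2); split; first exact: Rmin_pos.
move=> B hB; have {h1}h1 := h1 B (Rlt_le_trans _ _ _ hB (Rmin_l _ _)).
have {h2}h2 := h2 B (Rlt_le_trans _ _ _ hB (Rmin_r _ _)).
have -> : mdist (psum A m.+1) (psum B m.+1) = mnorm
    (madd (madd (psum A m) (mopp (psum B m))) (madd (mpow A m.+1) (mopp (mpow B m.+1)))).
  by rewrite /mdist; congr mnorm; rewrite !psumSr; mring.
by apply: Rle_lt_trans (mnorm_add _ _) _; rewrite -!/(mdist _ _); lra.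
Qed.

Section Irreducible.
Variables (n : nat) (K : vec n -> Prop).
Hypothesis Kproper : proper_cone K.
Implicit Types (x y z e : vec n) (A B : mat n).

Lemma in_pi_mul A B : in_pi K A -> in_pi K B -> in_pi K (mmul A B).
Proof. by move=> hA hB x Kx; rewrite mapply_mul; apply: hA; exact: hB. Qed.

Lemma in_pi_id : in_pi K (@mid n).
Proof. by move=> x; rewrite mapply_id. Qed.

Lemma in_pi_mpow A k : in_pi K A -> in_pi K (mpow A k).
Proof. by move=> hA; elim: k => [|k]; [exact: in_pi_id|exact: in_pi_mul]. Qed.

Lemma in_pi_psum A m : in_pi K A -> in_pi K (psum A m).
Proof.
move=> hA; elim: m => [|m IH]; first exact: in_pi_id.
move=> x Kx; rewrite /psum -/psum mapplyDl; apply: cone_add => //; first exact: IH.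
exact: in_pi_mpow.
Qed.

Lemma psum_mono A m d x : in_pi K A -> K x ->
  Kge K (mapply (psum A (m + d)) x) (mapply (psum A m) x).
Proof.
move=> hA Kx; elim: d => [|d IH]; first by rewrite addn0; exact: Kge_refl.
rewrite addnS; apply: Kge_trans IH => //; rewrite /= mapplyDl.
rewrite /Kge; set u := mapply (psum A _) x; set v := mapply _ x.
have -> : vadd (vadd u v) (vopp u) = v by vring.
exact: (@in_pi_mpow A (m + d).+1).
Qed.

(* The vectors dominated by a multiple of some [psum A m x] form an invariant
   face, which by irreducibility is all of [K]. *)
Lemma irreducible_orbit A x y : K_irreducible K A -> K x -> x <> @vzero n -> K y ->
  exists m c, 0 <= c /\ Kge K (vscale c (mapply (psum A m) x)) y.
Proof.
move=> [hA irr] Kx x0 Ky.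
pose F z := K z /\ exists m c, 0 <= c /\ Kge K (vscale c (mapply (psum A m) x)) z.
suff : F y by case.
apply: NNPP => nFy; apply: irr; exists F; split; last first.
  move=> z [Kz [m [c [c0 hz]]]]; split; first exact: hA.
  exists m.+1, c; split=> //.
  apply: Kge_trans (_ : Kge K _ (mapply A (vscale c (mapply (psum A m) x)))) _ => //.
    rewrite mapplyZr; apply: Kge_scale => //.
    rewrite psumSl mapplyDl mapply_id mapply_mul /Kge.
    by set v := mapply _ _; have -> : vadd (vadd x v) (vopp v) = x by vring.
  exact: Kge_mapply.
have Fx : F x.
  split=> //; exists 0%N, 1; split; first lra.
  by rewrite mapply_id (_ : vscale 1 x = x); [exact: Kge_refl|vring].
split; last by split; [exists x|exists y].
split.
  split; first by exists x.
  move=> r z r0 [Kz [m [c [c0 hz]]]]; split; first by apply: cone_scale => //; lra.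
  exists m, (r * c); split; first by apply: Rmult_le_pos; lra.
  have -> : vscale (r * c) (mapply (psum A m) x) = vscale r (vscale c (mapply (psum A m) x)).
    by vring.
  by apply: Kge_scale => //; lra.
split.
  move=> z1 z2 t [Kz1 [m1 [c1 [c10 h1]]]] [Kz2 [m2 [c2 [c20 h2]]]] t01.
  split; first by have [_ [cvx _]] := Kproper; exact: cvx.
  exists (m1 + m2)%N, (t * c1 + (1 - t) * c2).
  split; first by apply: Rplus_le_le_0_compat; apply: Rmult_le_pos; lra.
  set u := mapply _ x.
  have -> : vscale (t * c1 + (1 - t) * c2) u =
    vadd (vscale t (vscale c1 u)) (vscale (1 - t) (vscale c2 u)) by vring.
  apply: Kge_add => //; apply: Kge_scale => //; try lra.
    by apply: Kge_trans h1 => //; apply: Kge_scale => //; exact: psum_mono.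
  by apply: Kge_trans h2 => //; apply: Kge_scale => //; rewrite /u addnC; exact: psum_mono.
split; first by move=> z [].
move=> z w [Kz [m [c [c0 hz]]]] zw Kw; split.
  by move: Kw; rewrite /Kge (_ : vadd w _ = w) //; vring.
by exists m, c; split=> //; exact: Kge_trans hz zw.
Qed.

(** In [irreducible_orbit] the exponent and the constant depend on [x]; compactness makes them
    uniform. Counterexamples [w k] to the pair [(k, 1/(k+1))] cluster at some [l]; the orbit of [l]
    dominates [e] up to a constant, hence so does that of a nearby [w q] with late index, a
    contradiction. *)
Lemma irreducible_uniform A e : K_irreducible K A -> order_unit K e ->
  exists m c, 0 < c /\ forall x, K x ->
    Kge K (mapply (psum A m) x) (vscale (c * vnorm x) e).
Proof.
move=> irr he; have hA := irr.1; have Ke := order_unit_cone he.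
apply: NNPP => nex.
have bad (k : nat) : exists x, K x /\ vnorm x = 1 /\
    ~ Kge K (mapply (psum A k) x) (vscale (/ INR k.+1) e).
  apply: NNPP => nk; apply: nex; exists k, (/ INR k.+1).
  split; first by apply: Rinv_0_lt_compat; apply: lt_0_INR; lia.
  move=> x Kx; case: (Req_dec (vnorm x) 0) => [x0|xn0].
    rewrite (vnorm_eq0 x0) mapply0 vnorm_zero Rmult_0_r.
    by rewrite (_ : vscale 0 e = @vzero n); [exact: Kge_refl|vring].
  have x0 : 0 < vnorm x by have := vnorm_ge0 x; lra.
  have c0 : 0 < / vnorm x by exact: Rinv_0_lt_compat.
  have c0' := Rlt_le _ _ c0.
  apply: NNPP => nK; apply: nk; exists (vscale (/ vnorm x) x).
  split; first by apply: cone_scale.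
  split; first by rewrite vnorm_scale //; field; lra.
  move=> /(Kge_scale Kproper (Rlt_le _ _ x0)); rewrite mapplyZr => h; apply: nK.
  congr Kge: h.
    by apply: vec_ext => i; rewrite /vscale; field; lra.
  by vring.
pose w k := proj1_sig (constructive_indefinite_description _ (bad k)).
have wP k : K (w k) /\ vnorm (w k) = 1 /\
    ~ Kge K (mapply (psum A k) (w k)) (vscale (/ INR k.+1) e).
  exact: (proj2_sig (constructive_indefinite_description _ (bad k))).
have [k|l hl] := @vec_bounded_cluster n w 1; first by have [_ [-> _]] := wP k; lra.
have Kl : K l.
  apply: (cone_closed Kproper) => eps /(hl _ 0%N)[q [_ hq]]; exists (w q).
  split; first by have [] := wP q.
  rewrite -vnorm_opp; apply: Rle_lt_trans hq; apply: Req_le; congr vnorm; vring.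
have l0 : l <> @vzero n.
  move=> l0; have [|q [_ hq]] := hl (1 / 2) 0%N; first lra.
  have [_ [h _]] := wP q.
  by move: hq; rewrite l0 (_ : vadd _ _ = w q) ?h; [lra|vring].
have [m [c [c0 hm]]] := irreducible_orbit irr Kl l0 Ke.
set P := psum A m in hm.
have n0 := pos_INR n; have P0 := mnorm_ge0 P.
have nP : 0 <= INR n * mnorm P by exact: Rmult_le_pos.
(* Only [0 <= c] is known; enlarging it permits division. *)
have [c' [c'0 cc']] : exists c', 0 < c' /\ c <= c' by exists (c + 1); lra.
have PK := @in_pi_psum A m hA.
have hm' : Kge K (mapply P l) (vscale (/ c') e).
  have : Kge K (vscale c' (mapply P l)) e.
    apply: Kge_trans hm => //; apply: Kge_scale_le => //; exact: PK.
  move=> /(Kge_scale Kproper (Rlt_le _ _ (Rinv_0_lt_compat _ c'0))).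
  by congr Kge; apply: vec_ext => i; rewrite /vscale; field; lra.
(* Moving [l] by less than [d] changes [P l] by at most [/ (2 * c')] in norm, which spends half of
   the lower bound [e / c']. *)
pose d := / (2 * c') / (INR n * mnorm P + 1).
have ic' : 0 < / (2 * c') by apply: Rinv_0_lt_compat; lra.
have d0 : 0 < d by apply: Rdiv_lt_0_compat; lra.
have [N [N0 hN]] := archimed_cor1 _ ic'.
have [q [qN hq]] := hl d (maxn N m) d0.
have [Kq [_ []]] := wP q.
have q0 : 0 < INR N by apply: lt_0_INR; lia.
have qle : / INR q.+1 <= / (2 * c').
  apply: Rle_trans (_ : / INR N <= _); last lra.
  by apply: Rinv_le_contravar => //; apply: le_INR; lia.
apply: (@Kge_trans _ _ Kproper (mapply P (w q))).
  have -> : psum A q = psum A (m + (q - m)) by congr psum; lia.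
  exact: psum_mono.
apply: (@Kge_trans _ _ Kproper (vscale (/ (2 * c')) e)); last exact: Kge_scale_le.
have hz : Kge K (vscale (/ (2 * c')) e) (vopp (mapply P (vadd (w q) (vopp l)))).
  apply: order_unit_Kge => //; rewrite vnorm_opp; apply: Rle_trans (vnorm_mapply _ _) _.
  have -> : / (2 * c') = (INR n * mnorm P + 1) * d by rewrite /d; field; lra.
  by apply: Rmult_le_compat; try lra; exact: vnorm_ge0.
have := Kge_add Kproper hm' hz; rewrite /Kge mapplyDr mapplyNr.
by congr K; apply: vec_ext => i; rewrite /vadd /vscale /vopp; field; lra.
Qed.

(** For a basis vector [z], the relation [-e <= z <= e] puts [A e + A z] between [0] and [2 A e].
    Normality bounds it by [2 * kappa * |A e|], and subtracting [A e] costs the extra [1]; the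
    vector [A z] is a column of [A]. *)
Lemma mnorm_order_unit A e kappa : in_pi K A -> order_unit K e ->
  (forall x y, K x -> Kge K y x -> vnorm x <= kappa * vnorm y) ->
  mnorm A <= (2 * kappa + 1) * vnorm (mapply A e).
Proof.
move=> hA he hk; have Ke := order_unit_cone he.
have Ae0 := vnorm_ge0 (mapply A e).
have k0 : 0 <= kappa * vnorm (mapply A e).
  apply: Rle_trans (hk _ _ (hA _ Ke) (Kge_refl Kproper _)); exact: vnorm_ge0.
apply: mnorm_le => [|i j]; first lra.
pose z : vec n := fun k => if j == k then 1 else 0.
have zn : vnorm z <= 1.
  by apply: vnorm_le => [|k]; [lra|rewrite /z; case: eqP => _; rewrite ?Rabs_R1 ?Rabs_R0; lra].
have zA : mapply A z = fun i => A i j.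
  apply: vec_ext => k; rewrite /mapply -[RHS](rsum_delta j (fun l => A k l)).
  by apply: eq_bigr => l _; rewrite /z; ring.
have h1 : K (vadd (mapply A e) (mapply A z)).
  rewrite -mapplyDr; apply: hA; have := he z 1 zn.
  by congr K; vring.
have h2 : Kge K (vscale 2 (mapply A e)) (vadd (mapply A e) (mapply A z)).
  have /hA : K (vadd e (vopp z)) by have := order_unit_Kge he zn; congr K; vring.
  by rewrite mapplyDr mapplyNr /Kge; congr K; vring.
have := hk _ _ h1 h2; rewrite vnorm_scale; last lra.
have : vnorm (mapply A z) <= vnorm (vadd (mapply A e) (mapply A z)) + vnorm (mapply A e).
  rewrite {1}(_ : mapply A z = vadd (vadd (mapply A e) (mapply A z)) (vopp (mapply A e))).
    by apply: Rle_trans (vnorm_add _ _) _; rewrite vnorm_opp; lra.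
  by vring.
have := vnorm_coord (mapply A z) i; rewrite {1}zA; lra.
Qed.

End Irreducible.

(** * Growth rates of discrete semigroups *)

Lemma powD (r : R) (s t : nat) : r ^ (s + t) = r ^ s * r ^ t.
Proof. by elim: s => [|s IH]; [rewrite add0n /=; ring|rewrite addSn /= IH; ring]. Qed.

(** Estimates in terms of the Hausdorff distance are proved for every [h] strictly above it, where
    witnesses exist; this passes to the limit. *)
Lemma le_of_forall_gt a b c : 0 <= c -> (forall x, b < x -> a <= c * x) -> a <= c * b.
Proof.
move=> c0 h; apply: Rnot_lt_le => ab.
pose eps := (a - c * b) / (2 * (c + 1)).
have e0 : 0 < eps by apply: Rdiv_lt_0_compat; lra.
have := h (b + eps); rewrite Rmult_plus_distr_l.
have : (c + 1) * eps = (a - c * b) / 2 by rewrite /eps; field; lra.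
lra.
Qed.

Section Semigroup.
Variable n : nat.
Implicit Types (N M : mat n -> Prop) (A B X Y : mat n).

(** The max-entry norm is submultiplicative only up to the factor [n]. These operator bounds
    multiply exactly, so that long products collect no further powers of [n]. *)
Definition left_bounded c A := forall X, mnorm (mmul A X) <= c * mnorm X.

Lemma left_bounded_mnorm A c : mnorm A <= c -> left_bounded (INR n * c) A.
Proof.
move=> Ac X; apply: Rle_trans (mnorm_mul _ _) _.
apply: Rmult_le_compat_r; first exact: mnorm_ge0.
by apply: Rmult_le_compat_l => //; exact: pos_INR.
Qed.

Lemma left_bounded_mul A B a b : 0 <= a ->
  left_bounded a A -> left_bounded b B -> left_bounded (a * b) (mmul A B).
Proof.
move=> a0 hA hB X; rewrite -mmulA; apply: Rle_trans (hA _) _.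
by rewrite Rmult_assoc; apply: Rmult_le_compat_l.
Qed.

Lemma left_bounded_id : left_bounded 1 (@mid n).
Proof. by move=> X; rewrite mmul1l; lra. Qed.

Lemma mnorm_left_bounded A c : 0 <= c -> left_bounded c A -> mnorm A <= c.
Proof.
move=> c0 /(_ (@mid n)); rewrite mmul1r => h; apply: Rle_trans h _.
by have := Rmult_le_compat_l _ _ _ c0 (mnorm_id_le1 n); lra.
Qed.

Lemma disc_St_mul N s t X Y :
  disc_St N s X -> disc_St N t Y -> disc_St N (s + t) (mmul X Y).
Proof.
elim: s X => [|s IH] X /=; first by move=> ->; rewrite mmul1l.
move=> [A [P [NA [hP ->]]]] hY; exists A, (mmul P Y); split=> //.
by split; [exact: IH|rewrite mmulA].
Qed.

Lemma disc_St_split N s t X : disc_St N (s + t) X ->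
  exists Y Z, disc_St N s Y /\ disc_St N t Z /\ X = mmul Y Z.
Proof.
elim: s X => [|s IH] X /=.
  by rewrite add0n => hX; exists (@mid n), X; rewrite mmul1l.
move=> [A [P [NA [/IH[Y [Z [hY [hZ ->]]]] ->]]]].
exists (mmul A Y), Z; split; first by exists A, Y.
by split=> //; rewrite mmulA.
Qed.

Lemma disc_St_one N A : N A -> disc_St N 1 A.
Proof. by move=> NA; exists A, (@mid n); rewrite mmul1r. Qed.

Lemma disc_St_nonempty N t : (exists A, N A) -> exists X, disc_St N t X.
Proof.
move=> [A NA]; elim: t => [|t [X hX]]; first by exists (@mid n).
by exists (mmul A X), A, X.
Qed.

Lemma disc_St_bound N c t X : 0 <= c -> (forall A, N A -> mnorm A <= c) ->
  disc_St N t X -> mnorm X <= (INR n * c) ^ t.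
Proof.
move=> c0 hN; have nc : 0 <= INR n * c by apply: Rmult_le_pos => //; exact: pos_INR.
elim: t X => [|t IH] X /=; first by move=> ->; exact: mnorm_id_le1.
move=> [A [P [NA [/IH hP ->]]]]; apply: Rle_trans (left_bounded_mnorm (hN A NA) P) _.
exact: Rmult_le_compat_l.
Qed.

Definition rate_bound N r :=
  exists C, forall t X, disc_St N t X -> mnorm X <= C * r ^ t.

(** The joint spectral radius as the infimum of the rates admitting a bound; the bound at [rho]
    itself is not part of it. *)
Definition is_rate N rho := 0 <= rho /\
  (forall r, rho < r -> rate_bound N r) /\
  (forall r, 0 < r -> rate_bound N r -> rho <= r).

(** One half of the Hausdorff distance, with a strict inequality so that a witness exists even where
    the infimum is not attained. *)
Definition close N1 N2 h := forall A, N1 A -> exists B, N2 B /\ mdist A B < h.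

Lemma rate_bound_mono N r r' : 0 <= r <= r' -> rate_bound N r -> rate_bound N r'.
Proof.
move=> [r0 rr'] [C hC]; exists (Rabs C) => t X /hC hX; apply: Rle_trans hX _.
apply: Rle_trans (_ : Rabs C * r ^ t <= _).
  by apply: Rmult_le_compat_r; [exact: pow_le|exact: Rle_abs].
by apply: Rmult_le_compat_l; [exact: Rabs_pos|exact: pow_incr].
Qed.

Lemma is_rate_exists N c : 0 <= c -> (forall A, N A -> mnorm A <= c) ->
  exists rho, is_rate N rho.
Proof.
move=> c0 hN; have nc : 0 <= INR n * c by apply: Rmult_le_pos => //; exact: pos_INR.
(* The infimum of the positive admissible rates, as the opposite of a supremum. *)
pose E x := 0 < - x /\ rate_bound N (- x).
have Eb : bound E by exists 0 => x [x0 _]; lra.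
have [|l [lub lst]] := completeness E Eb.
  exists (- (INR n * c + 1)); split; rewrite Ropp_involutive; first lra.
  apply: (@rate_bound_mono _ (INR n * c)); first lra.
  by exists 1 => t X hX; rewrite Rmult_1_l; exact: disc_St_bound hX.
exists (- l); split.
  by have := lst 0 (fun x hx => ltac:(case: hx; lra)); lra.
split=> [r lr|r r0 hr]; last first.
  by have := lub (- r); rewrite /E Ropp_involutive => /(_ (conj r0 hr)); lra.
apply: NNPP => nb; suff : l <= - r by lra.
apply: lst => x [x0 hx]; apply: Rnot_lt_le => xr; apply: nb.
by apply: rate_bound_mono hx; lra.
Qed.

Lemma is_rate_le N rho c : 0 <= c -> (forall A, N A -> mnorm A <= c) ->
  is_rate N rho -> rho <= INR n * c + 1.
Proof.
move=> c0 hN [_ [_ h]].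
have nc : 0 <= INR n * c by apply: Rmult_le_pos => //; exact: pos_INR.
apply: h; first lra.
apply: (@rate_bound_mono _ (INR n * c)); first lra.
by exists 1 => t X hX; rewrite Rmult_1_l; exact: disc_St_bound hX.
Qed.

(* Otherwise submultiplicativity would propagate the bound [q ^ t] at the single
   time [t] to all times. *)
Lemma is_rate_lower N rho c t q : 0 <= c -> (forall A, N A -> mnorm A <= c) ->
  is_rate N rho -> (0 < t)%N -> 0 < q < rho ->
  exists X, disc_St N t X /\ q ^ t <= (INR n + 1) * mnorm X.
Proof.
move=> c0 hN [_ [_ h]] t0 [q0 qr]; apply: NNPP => nex.
have n0 := pos_INR n.
have nc : 0 <= INR n * c by exact: Rmult_le_pos.
have small X : disc_St N t X -> INR n * mnorm X <= q ^ t.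
  move=> hX; apply: Rnot_lt_le => lt; apply: nex; exists X; split=> //.
  have := mnorm_ge0 X; lra.
suff : rho <= q by lra.
(* In [s = k t + s'] with [s' < t], each full block contributes at most [q ^ t], and the remainder
   at most [(n c) ^ s' <= a ^ t * q ^ s']. *)
apply: h => //; pose a := Rmax 1 (INR n * c / q).
have a1 : 1 <= a by exact: Rmax_l.
have aq : INR n * c <= a * q.
  have -> : INR n * c = INR n * c / q * q by field; lra.
  by apply: Rmult_le_compat_r; [lra|exact: Rmax_r].
exists (a ^ t) => s; elim/ltn_ind: s => s IH X.
case: (ltnP s t) => st hX.
  apply: Rle_trans (disc_St_bound c0 hN hX) _.
  apply: Rle_trans (pow_incr _ _ s (conj nc aq)) _.
  rewrite Rpow_mult_distr; apply: Rmult_le_compat_r; first by apply: pow_le; lra.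
  by apply: Rle_pow => //; lia.
have e : s = (t + (s - t))%N by lia.
rewrite e in hX; have [Y [Z [hY [hZ ->]]]] := disc_St_split hX.
apply: Rle_trans (mnorm_mul _ _) _; rewrite [in q ^ s]e powD.
apply: Rle_trans (_ : q ^ t * mnorm Z <= _).
  by apply: Rmult_le_compat_r; [exact: mnorm_ge0|exact: small].
have := IH (s - t)%N _ Z hZ => /(_ ltac:(lia)) hh.
have qt : 0 <= q ^ t by apply: pow_le; lra.
have := Rmult_le_compat_l _ _ _ qt hh; lra.
Qed.

(** Replacing a factor of [N1] by one of [N2] leaves an error [A - B] that separates two blocks and
    costs one more [G] and two factors [n]; this cost is absorbed into the rate. The induction
    carries a left factor [Y], so that the factors already replaced form a single block, bounded
    with a single [G]. *)
Lemma growth_perturbation N1 N2 G r h :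
  0 <= G -> 0 <= r -> 0 <= h -> (forall t X, disc_St N2 t X -> mnorm X <= G * r ^ t) ->
  close N1 N2 h -> forall t X, disc_St N1 t X ->
  mnorm X <= G * (r + INR n * INR n * G * h) ^ t.
Proof.
move=> G0 r0 h0 hN2 cl; have n0 := pos_INR n.
have nn : 0 <= INR n * INR n by exact: Rmult_le_pos.
have nG : 0 <= INR n * INR n * G * h by do 2 apply: Rmult_le_pos => //.
set b := r + _; have b0 : 0 <= b by rewrite /b; lra.
suff main t X : disc_St N1 t X -> forall s Y, disc_St N2 s Y ->
    mnorm (mmul Y X) <= G * r ^ s * b ^ t.
  by move=> t X /main /(_ 0%N (@mid n) erefl); rewrite mmul1l /= Rmult_1_r.
elim: t X => [|t IH] X /=.
  by move=> -> s Y /hN2; rewrite mmul1r Rmult_1_r.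
move=> [A [P [NA [/IH hP ->]]]] s Y hY; have [B [NB AB]] := cl A NA.
have -> : mmul Y (mmul A P) =
    madd (mmul (mmul Y B) P) (mmul Y (mmul (madd A (mopp B)) P)).
  rewrite mmulBl mmulBr -!mmulA; mring.
apply: Rle_trans (mnorm_add _ _) _.
have h1 := hP (s + 1)%N _ (disc_St_mul hY (disc_St_one NB)).
have Yn := hN2 _ _ hY.
have Pn := hP 0%N _ (erefl : disc_St N2 0 (@mid n)).
rewrite mmul1l /= Rmult_1_r in Pn; rewrite powD /= Rmult_1_r in h1.
have rs : 0 <= r ^ s by exact: pow_le.
have bt : 0 <= b ^ t by exact: pow_le.
have h2 : mnorm (mmul Y (mmul (madd A (mopp B)) P)) <= INR n * (G * r ^ s) * (INR n * h * (G * b ^ t)).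
  apply: Rle_trans (mnorm_mul _ _) _.
  apply: Rmult_le_compat; try exact: mnorm_ge0; try exact: Rmult_le_pos (mnorm_ge0 _).
    exact: Rmult_le_compat_l.
  apply: Rle_trans (mnorm_mul _ _) _; rewrite -/(mdist A B).
  apply: Rmult_le_compat => //; try exact: mnorm_ge0.
    by apply: Rmult_le_pos => //; exact: mdist_ge0.
  by apply: Rmult_le_compat_l => //; lra.
apply: Rle_trans (Rplus_le_compat _ _ _ _ h1 h2) _.
by apply: Req_le; rewrite /b; ring.
Qed.

Lemma mconv_close N1 N2 h B : close N1 N2 h -> mconv N1 B ->
  exists B', mconv N2 B' /\ mdist B B' <= h.
Proof.
move=> cl [l [hl [w1 ->]]].
suff [l' [hl' [w' d]]] : exists l', (forall p, List.In p l' -> 0 <= fst p /\ N2 (snd p)) /\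
    wsum l' = wsum l /\ mdist (mcomb l) (mcomb l') <= wsum l * h.
  exists (mcomb l'); split; first by exists l'; rewrite w'.
  by move: d; rewrite w1 Rmult_1_l.
elim: l hl {w1} => [|[c A] l IH] hl.
  by exists [::]; split=> //; rewrite /= mdist_refl; split=> //; lra.
have [|l' [hl' [w' d]]] := IH; first by move=> p pl; apply: hl; right.
have [c0 /cl[A' [NA' AA']]] := hl (c, A) (or_introl erefl).
exists ((c, A') :: l'); split; first by move=> p [<-|/hl'].
rewrite /= w'; split=> //.
have -> : mdist (madd (mscale c A) (mcomb l)) (madd (mscale c A') (mcomb l')) =
  mnorm (madd (mscale c (madd A (mopp A'))) (madd (mcomb l) (mopp (mcomb l')))).
  by rewrite /mdist; congr mnorm; mring.
apply: Rle_trans (mnorm_add _ _) _; rewrite -/(mdist (mcomb l) _) Rmult_plus_distr_r.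
apply: Rplus_le_compat => //; apply: Rle_trans (mnorm_scale_le _ _) _.
rewrite Rabs_pos_eq //; apply: Rmult_le_compat_l => //; exact: Rlt_le AA'.
Qed.

Lemma vnorm_mcomb_le Y (w : vec n) l b :
  (forall p, List.In p l -> 0 <= fst p /\ vnorm (mapply Y (mapply (snd p) w)) <= b) ->
  vnorm (mapply Y (mapply (mcomb l) w)) <= wsum l * b.
Proof.
elim: l => [|[c A] l IH] hl /=.
  by rewrite mapply_mzero mapply0 vnorm_zero; lra.
have [c0 hb] := hl (c, A) (or_introl erefl).
rewrite mapplyDl mapplyDr mapplyZl mapplyZr Rmult_plus_distr_r.
apply: Rle_trans (vnorm_add _ _) _; apply: Rplus_le_compat.
  by rewrite vnorm_scale //; exact: Rmult_le_compat_l.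
by apply: IH => p pl; apply: hl; right.
Qed.

End Semigroup.

(** * Uniform growth of positive semigroups *)

Section Growth.
Variables (n : nat) (K : vec n -> Prop).
Hypothesis Kproper : proper_cone K.
Implicit Types (N M : mat n -> Prop) (A B X Y : mat n).

Lemma disc_St_in_pi N t X : (forall A, N A -> in_pi K A) -> disc_St N t X -> in_pi K X.
Proof.
move=> hN; elim: t X => [|t IH] X /=; first by move=> ->; exact: in_pi_id.
by move=> [A [P [NA [/IH hP ->]]]]; apply: in_pi_mul => //; exact: hN.
Qed.

(* With [beta] the supremum of [|X e| / r ^ t], positivity of [psum B m] gives
   [c * beta ^ 2 <= kappa * beta * sum r ^ k], which bounds [beta] independently
   of the constant hidden in [rate_bound N r]. *)
Lemma uniform_growth N B m e kappa c r :
  (forall A, N A -> in_pi K A) -> mconv N B -> order_unit K e -> 0 < kappa ->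
  (forall x y, K x -> Kge K y x -> vnorm x <= kappa * vnorm y) -> 0 < c ->
  (forall x, K x -> Kge K (mapply (psum B m) x) (vscale (c * vnorm x) e)) ->
  0 < r -> rate_bound N r -> forall t X, disc_St N t X ->
  mnorm X <= (2 * kappa + 1) * (kappa / c * sum_f_R0 (fun k => r ^ k) m) * r ^ t.
Proof.
move=> hN [l [hl [w1 Bl]]] he k0 hk c0 hB r0 [C hC].
have Ke := order_unit_cone he.
have rp t : 0 < r ^ t by exact: pow_lt.
pose E v := exists t X, disc_St N t X /\ v = vnorm (mapply X e) / r ^ t.
have Eb : bound E.
  exists (INR n * C * vnorm e) => v [t [X [hX ->]]].
  apply: (Rmult_le_reg_r (r ^ t)) => //; rewrite /Rdiv Rmult_assoc Rinv_l; last by have := rp t; lra.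
  rewrite Rmult_1_r; apply: Rle_trans (vnorm_mapply _ _) _.
  have -> : INR n * C * vnorm e * r ^ t = INR n * (C * r ^ t) * vnorm e by ring.
  apply: Rmult_le_compat_r; first exact: vnorm_ge0.
  by apply: Rmult_le_compat_l; [exact: pos_INR|exact: hC].
have En : exists v, E v by exists (vnorm (mapply (@mid n) e) / r ^ 0), 0%N, (@mid n).
have [beta [bub blst]] := completeness E Eb En.
have hb t X : disc_St N t X -> vnorm (mapply X e) <= beta * r ^ t.
  move=> hX; have : vnorm (mapply X e) / r ^ t <= beta by apply: bub; exists t, X.
  move=> /(Rmult_le_compat_r _ _ _ (Rlt_le _ _ (rp t))).
  by rewrite /Rdiv Rmult_assoc Rinv_l ?Rmult_1_r //; have := rp t; lra.
(* [mpow B k] is a convex combination of products of length [k]. Instead of listing them, the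
   induction moves one factor at a time into [S]. *)
have conv k s S t T : disc_St N s S -> disc_St N t T ->
    vnorm (mapply S (mapply (mpow B k) (mapply T e))) <= beta * r ^ (s + k + t).
  elim: k s S => [|k IH] s S hS hT.
    by rewrite mapply_id addn0 -mapply_mul; apply: hb; exact: disc_St_mul.
  rewrite /= mapply_mul Bl -[X in _ <= X]Rmult_1_l -w1; apply: vnorm_mcomb_le => p pl.
  have [p0 Np] := hl p pl; split=> //.
  rewrite -mapply_mul -Bl (_ : (s + k.+1 + t = s + 1 + k + t)%N); last by lia.
  by apply: IH => //; apply: disc_St_mul => //; exact: disc_St_one.
set G := sum_f_R0 _ m.
have G0 : 0 < G.
  rewrite /G; elim: m {hB G} => [|m IH] /=; first lra.
  by have := rp m.+1; rewrite /= in IH *; lra.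
have psumb s S t T : disc_St N s S -> disc_St N t T ->
    vnorm (mapply S (mapply (psum B m) (mapply T e))) <= beta * G * (r ^ s * r ^ t).
  move=> hS hT; rewrite /G; elim: m {hB G G0} => [|m IH].
    by have := conv 0%N _ _ _ _ hS hT; rewrite addn0 powD /=; lra.
  rewrite psumSr mapplyDl mapplyDr; apply: Rle_trans (vnorm_add _ _) _.
  have := conv m.+1 _ _ _ _ hS hT; rewrite !powD; rewrite [sum_f_R0 _ m.+1]/=.
  by rewrite -/(r ^ m.+1); lra.
have key u v : E u -> E v -> c * u * v <= kappa * beta * G.
  move=> [s [S [hS ->]]] [t [T [hT ->]]].
  have SK := disc_St_in_pi hN hS; have TK := disc_St_in_pi hN hT.
  have KSe := SK _ Ke.
  have h1 : Kge K (mapply S (mapply (psum B m) (mapply T e)))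
      (vscale (c * vnorm (mapply T e)) (mapply S e)).
    by rewrite -mapplyZr; apply: Kge_mapply => //; apply: hB; exact: TK.
  have cT : 0 <= c * vnorm (mapply T e).
    by apply: Rmult_le_pos; [lra|exact: vnorm_ge0].
  have := hk _ _ (cone_scale Kproper cT KSe) h1; rewrite vnorm_scale // => h2.
  have h3 := Rmult_le_compat_l _ _ _ (Rlt_le _ _ k0) (psumb _ _ _ _ hS hT).
  have rst : 0 < r ^ s * r ^ t by exact: Rmult_lt_0_compat.
  apply: (Rmult_le_reg_r (r ^ s * r ^ t)) => //.
  have -> : c * (vnorm (mapply S e) / r ^ s) * (vnorm (mapply T e) / r ^ t) * (r ^ s * r ^ t) =
     c * vnorm (mapply T e) * vnorm (mapply S e).
    by field; split; apply: Rgt_not_eq; exact: rp.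
  lra.
have bG : beta <= kappa / c * G.
  apply: Rnot_lt_le => lt.
  have kG : 0 < kappa / c * G by apply: Rmult_lt_0_compat => //; exact: Rdiv_lt_0_compat.
  have [u [Eu hu]] : exists u, E u /\ kappa / c * G < u.
    apply: NNPP => nu; suff : beta <= kappa / c * G by lra.
    by apply: blst => u Eu; apply: Rnot_lt_le => h; apply: nu; exists u.
  have u0 : 0 < u by lra.
  (* The supremum over [v] in [key], for fixed [u]. As [beta] is finite and positive it can be
     cancelled, which contradicts the choice of [u]. *)
  have : beta <= kappa / c * G * beta / u.
    apply: blst => v Ev; have := key u v Eu Ev => h.
    apply: (Rmult_le_reg_l (c * u)); first exact: Rmult_lt_0_compat.
    by have -> : c * u * (kappa / c * G * beta / u) = kappa * beta * G by field; lra.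
  move=> /(Rmult_le_compat_r _ _ _ (Rlt_le _ _ u0)).
  have -> : kappa / c * G * beta / u * u = kappa / c * G * beta by field; lra.
  have b0 : 0 < beta by lra.
  by have := Rmult_lt_compat_r _ _ _ b0 hu; lra.
move=> t X hX; have XK := disc_St_in_pi hN hX.
apply: Rle_trans (mnorm_order_unit Kproper XK he hk) _; rewrite Rmult_assoc.
apply: Rmult_le_compat_l; first lra.
apply: Rle_trans (hb _ _ hX) _; apply: Rmult_le_compat_r => //; exact: Rlt_le.
Qed.

(** Uniformity lies in the order of quantifiers: [delta] and [L] precede [N1] and [N2]. The
    perturbation bound is used at rates [r] above [rho2] with one [G] for all [r <= R0], and [r]
    then decreases to [rho2]. *)
Lemma rate_loc_lipschitz M B c0 : mconv M B -> K_irreducible K B -> 0 <= c0 ->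
  exists delta L, 0 < delta /\ 0 <= L /\ forall N1 N2 h rho1 rho2,
    (forall A, N2 A -> in_pi K A) -> (forall A, N2 A -> mnorm A <= c0) ->
    close M N2 delta -> 0 <= h -> close N1 N2 h ->
    is_rate N1 rho1 -> is_rate N2 rho2 -> rho1 <= rho2 + L * h.
Proof.
move=> MB irr c00.
have [e he] := order_unit_exists Kproper.
have [kappa [k0 hk]] := cone_normal Kproper.
have [m [c [cp hc]]] := irreducible_uniform Kproper irr he.
have n0 := pos_INR n.
(* At this tolerance the change of [psum B m] costs at most half of [c]; [INR n + 1] passes from the
   entry norm to the action on vectors. *)
have [|d [dp hd]] := @psum_cont n B m (c / (2 * (INR n + 1))).
  by apply: Rdiv_lt_0_compat; lra.
(* By [is_rate_le], [rho2 <= INR n * c0 + 1]; the further [1] leaves room for rates strictly above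
   [rho2]. *)
pose R0 := INR n * c0 + 2.
pose G := (2 * kappa + 1) * (kappa / (c / 2) * sum_f_R0 (fun k => R0 ^ k) m).
have nc0 : 0 <= INR n * c0 by exact: Rmult_le_pos.
have S0 r : 0 <= r -> 0 <= sum_f_R0 (fun k => r ^ k) m.
  by move=> r0; apply: cond_pos_sum => k; exact: pow_le.
have kc : 0 < kappa / (c / 2) by apply: Rdiv_lt_0_compat; lra.
have G0 : 0 <= G.
  rewrite /G; apply: Rmult_le_pos; first lra.
  by apply: Rmult_le_pos; [lra|apply: S0; rewrite /R0; lra].
exists (d / 2), (INR n * INR n * G); split; first lra.
split; first by do 2 apply: Rmult_le_pos => //.
move=> N1 N2 h rho1 rho2 piN2 bN2 clM h0 clN rt1 rt2.
have [B' [NB' BB']] := mconv_close clM MB.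
have PB : mdist (psum B m) (psum B' m) < c / (2 * (INR n + 1)) by apply: hd; lra.
have hB' x : K x -> Kge K (mapply (psum B' m) x) (vscale (c / 2 * vnorm x) e).
  move=> Kx; have h1 := hc x Kx.
  have h2 : Kge K (vscale (c / 2 * vnorm x) e)
      (mapply (madd (psum B m) (mopp (psum B' m))) x).
    apply: order_unit_Kge => //; apply: Rle_trans (vnorm_mapply _ _) _.
    apply: Rmult_le_compat_r; first exact: vnorm_ge0.
    rewrite -/(mdist _ _).
    have -> : c / 2 = (INR n + 1) * (c / (2 * (INR n + 1))) by field; lra.
    by apply: Rmult_le_compat; try lra; exact: mdist_ge0.
  have := Kge_add Kproper h1 h2; rewrite /Kge mapplyDl mapplyNl.
  by congr K; apply: vec_ext => i; rewrite /vadd /vscale /vopp; field.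
have c2 : 0 < c / 2 by lra.
have r2le : rho2 <= INR n * c0 + 1 by exact: is_rate_le rt2.
have main r : rho2 < r <= R0 -> rho1 <= r + INR n * INR n * G * h.
  move=> [r1 r2].
  have r0 : 0 < r by have [? _] := rt2; lra.
  have nG : 0 <= INR n * INR n * G * h by do 3 apply: Rmult_le_pos => //.
  have gr := uniform_growth piN2 NB' he k0 hk c2 hB' r0 (rt2.2.1 r r1).
  have gr' t X : disc_St N2 t X -> mnorm X <= G * r ^ t.
    move=> hX; apply: Rle_trans (gr t X hX) _.
    apply: Rmult_le_compat_r; first by apply: pow_le; lra.
    apply: Rmult_le_compat_l; first lra.
    apply: Rmult_le_compat_l; first lra.
    by apply: sum_Rle => k _; apply: pow_incr; lra.
  apply: rt1.2.2; first lra.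
  exists G => t X hX; exact: (growth_perturbation G0 (Rlt_le _ _ r0) h0 gr' clN hX).
apply: Rnot_lt_le => lt.
pose eps := Rmin (1 / 2) ((rho1 - (rho2 + INR n * INR n * G * h)) / 2).
have e0 : 0 < eps by apply: Rmin_pos; lra.
have e1 : eps <= 1 / 2 by exact: Rmin_l.
have e2 : eps <= (rho1 - (rho2 + INR n * INR n * G * h)) / 2 by exact: Rmin_r.
have := main (rho2 + eps); rewrite /R0; lra.
Qed.

End Growth.

(** * The Hausdorff distance and the discrete radius *)

(** [Rsup] is a choice, and is a least upper bound once one is known to exist; hence the explicit
    bounds here and in the lemmas on [Rinf]. *)
Lemma Rsup_is_lub (E : R -> Prop) c :
  (exists x, E x) -> (forall x, E x -> x <= c) -> is_lub E (Rsup E).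
Proof.
move=> En Ec; apply: epsilon_spec.
have Eb : bound E by exists c.
by have [l hl] := completeness E Eb En; exists l.
Qed.

Lemma Rinf_witness (E : R -> Prop) c h : (exists x, E x) -> (forall x, E x -> c <= x) ->
  Rinf E < h -> exists x, E x /\ x < h.
Proof.
move=> [x0 Ex0] Ec lt; apply: NNPP => nex.
have [|x Ex|ub lst] := @Rsup_is_lub (fun x => E (- x)) (- c).
- by exists (- x0); rewrite Ropp_involutive.
- by have := Ec _ Ex; lra.
have : Rsup (fun x => E (- x)) <= - h; last by rewrite /Rinf in lt; lra.
apply: lst => x Ex; apply: Rnot_lt_le => hx; apply: nex; exists (- x).
by split=> //; lra.
Qed.

Lemma Rinf_le (E : R -> Prop) c x : (forall x, E x -> c <= x) -> E x -> Rinf E <= x.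
Proof.
move=> Ec Ex; have [|y Ey|ub lst] := @Rsup_is_lub (fun x => E (- x)) (- c).
- by exists (- x); rewrite Ropp_involutive.
- by have := Ec _ Ey; lra.
by have := ub (- x); rewrite Ropp_involutive /Rinf => /(_ Ex); lra.
Qed.

Section Hausdorff.
Variable n : nat.
Implicit Types (M N : mat n -> Prop) (A B : mat n).

(** [d] is abstract because the two halves of the Hausdorff distance use [mdist] with its arguments
    in opposite roles. *)
Lemma directed_hausdorff_close (d : mat n -> mat n -> R) M N c h :
  (forall A B, 0 <= d A B) -> (forall A B, M A -> N B -> d A B <= c) ->
  (exists B, N B) -> Rsup (fun r => exists A, M A /\ r = Rinf (fun s => exists B, N B /\ s = d A B)) < h ->
  forall A, M A -> exists B, N B /\ d A B < h.
Proof.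
move=> d0 dc [B0 NB0] lt A MA.
have inf A' : Rinf (fun s => exists B, N B /\ s = d A' B) <= d A' B0.
  by apply: (@Rinf_le _ 0) => [x [B [_ ->]]|]; [exact: d0|exists B0].
have [|x [A' [MA' ->]]|ub _] := @Rsup_is_lub
    (fun r => exists A, M A /\ r = Rinf (fun s => exists B, N B /\ s = d A B)) c.
- by exists (Rinf (fun s => exists B, N B /\ s = d A B)), A.
- by apply: Rle_trans (inf A') _; exact: dc.
have [| | |x [[B [NB xE]] hB]] := @Rinf_witness (fun s => exists B, N B /\ s = d A B) 0 h.
- by exists (d A B0), B0.
- by move=> x [B [_ ->]].
- by apply: Rle_lt_trans (ub _ _) lt; exists A.
by exists B; rewrite -xE.
Qed.

Lemma hausdorff_close M N cM cN h :
  (forall A, M A -> mnorm A <= cM) -> (forall A, N A -> mnorm A <= cN) ->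
  (exists A, M A) -> (exists A, N A) -> hausdorff M N < h -> close M N h /\ close N M h.
Proof.
move=> hM hN Mn Nn lt.
have dc A B : M A -> N B -> mdist A B <= cM + cN.
  move=> /hM MA /hN NB; apply: Rle_trans (mnorm_add _ _) _; rewrite mnorm_opp; lra.
split=> A; last first.
  move=> NA; have [||||B [MB hB]] := @directed_hausdorff_close (fun A B => mdist B A) N M (cM + cN) h _ _ _ _ A NA => //.
  - by move=> *; exact: mdist_ge0.
  - by move=> A' B' ? ?; exact: dc.
  - by apply: Rle_lt_trans lt; exact: Rmax_r.
  by exists B; rewrite mdistC.
apply: (@directed_hausdorff_close (@mdist n) M N (cM + cN) h) => //.
- by move=> *; exact: mdist_ge0.
- by apply: Rle_lt_trans lt; exact: Rmax_l.
Qed.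

Lemma hausdorff_ge0 M N cM cN :
  (forall A, M A -> mnorm A <= cM) -> (forall A, N A -> mnorm A <= cN) ->
  (exists A, M A) -> (exists A, N A) -> 0 <= hausdorff M N.
Proof.
move=> hM hN Mn Nn; apply: Rnot_lt_le => lt.
have [cl _] := hausdorff_close hM hN Mn Nn lt; have [A MA] := Mn.
by have [B [_ hB]] := cl A MA; have := mdist_ge0 A B; lra.
Qed.

Lemma close_bound M N c h : (forall A, M A -> mnorm A <= c) -> close N M h ->
  forall A, N A -> mnorm A <= c + h.
Proof.
move=> hM cl A /cl[B [/hM hB AB]]; have := mnorm_mdist A B; lra.
Qed.

End Hausdorff.

(** * Roots of exponentially growing quantities *)

Lemma exp_le_compat x y : x <= y -> exp x <= exp y.
Proof. by case=> [h|->]; [apply: Rlt_le; exact: exp_increasing|lra]. Qed.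

Lemma root_t_le x t u : 0 < t -> 0 < x -> ln x <= t * u -> root_t x t <= exp u.
Proof.
move=> t0 x0 h; rewrite /root_t; case: Rlt_dec => [h0|/(_ x0)//]; rewrite /Rpower.
apply: exp_le_compat.
have := Rmult_le_compat_l _ _ _ (Rlt_le _ _ (Rinv_0_lt_compat _ t0)) h.
rewrite -Rmult_assoc Rinv_l; lra.
Qed.

Lemma root_t_ge x t u : 0 < t -> 0 < x -> t * u <= ln x -> exp u <= root_t x t.
Proof.
move=> t0 x0 h; rewrite /root_t; case: Rlt_dec => [h0|/(_ x0)//]; rewrite /Rpower.
apply: exp_le_compat.
have := Rmult_le_compat_l _ _ _ (Rlt_le _ _ (Rinv_0_lt_compat _ t0)) h.
rewrite -Rmult_assoc Rinv_l; lra.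
Qed.

Lemma ln_mult_Rpower c q t : 0 < c -> 0 < q -> ln (c * Rpower q t) = ln c + t * ln q.
Proof. by move=> c0 q0; rewrite ln_mult ?ln_exp //; exact: exp_pos. Qed.

Lemma ln_le_compat x y : 0 < x -> x <= y -> ln x <= ln y.
Proof. by move=> x0 [h|->]; [apply: Rlt_le; exact: ln_increasing|lra]. Qed.

Lemma root_t_cvg (T : Type) (tau g : T -> R) rho : 0 <= rho ->
  (forall k, 1 <= tau k -> 0 <= g k) ->
  (forall q, 0 < q < rho ->
    exists c, 0 < c /\ forall k, 1 <= tau k -> c * Rpower q (tau k) <= g k) ->
  (forall q, rho < q -> exists C, forall k, 1 <= tau k -> g k <= C * Rpower q (tau k)) ->
  forall eps, 0 < eps ->
  exists T0, forall k, T0 <= tau k -> Rabs (root_t (g k) (tau k) - rho) < eps.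
Proof.
move=> r0 g0 lo up eps eps0.
have rt0 x t : 0 <= root_t x t.
  by rewrite /root_t; case: Rlt_dec => h /=; [apply: Rlt_le; exact: exp_pos|lra].
have [T1 hT1] : exists T1, forall k, T1 <= tau k -> root_t (g k) (tau k) < rho + eps.
  have [|C hC] := up (rho + eps / 4); first lra.
  pose C' := Rmax 1 C; have C'1 : 1 <= C' by exact: Rmax_l.
  (* The gap [d] between these logarithms absorbs [ln C'] once the time exceeds [ln C' / d]; [C']
     was kept at least [1] so that its logarithm makes sense. *)
  have lt : ln (rho + eps / 4) < ln (rho + eps / 2) by apply: ln_increasing; lra.
  set d := ln (rho + eps / 2) - ln (rho + eps / 4).
  have d0 : 0 < d by rewrite /d; lra.
  exists (Rmax 1 (ln C' / d)) => k hk.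
  have k1 : 1 <= tau k by apply: Rle_trans hk; exact: Rmax_l.
  have k2 : ln C' / d <= tau k by apply: Rle_trans hk; exact: Rmax_r.
  case: (Rle_lt_dec (g k) 0) => [gk|gk].
    by rewrite /root_t; case: Rlt_dec => ? /=; lra.
  apply: Rle_lt_trans (_ : rho + eps / 2 < _); last lra.
  rewrite -[X in _ <= X]exp_ln; last lra.
  apply: root_t_le => //; first lra.
  apply: Rle_trans (_ : ln (C' * Rpower (rho + eps / 4) (tau k)) <= _).
    apply: ln_le_compat => //; apply: Rle_trans (hC k k1) _.
    by apply: Rmult_le_compat_r; [apply: Rlt_le; exact: exp_pos|exact: Rmax_r].
  rewrite ln_mult_Rpower; [|lra|lra].
  have := Rmult_le_compat_r _ _ _ (Rlt_le _ _ d0) k2.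
  have -> : ln C' / d * d = ln C' by field; lra.
  rewrite {1}/d; lra.
have [T2 hT2] : exists T2, forall k, T2 <= tau k -> rho - eps < root_t (g k) (tau k).
  (* For [rho < eps] the lower bound is trivial, roots being nonnegative; otherwise [rho - eps / 2]
     is a positive base below [rho]. *)
  case: (Rlt_le_dec rho eps) => re.
    by exists 0 => k _; have := rt0 (g k) (tau k); lra.
  have [|c [c0 hc]] := lo (rho - eps / 2); first lra.
  have lt : ln (rho - eps * (3 / 4)) < ln (rho - eps / 2) by apply: ln_increasing; lra.
  set d := ln (rho - eps / 2) - ln (rho - eps * (3 / 4)).
  have d0 : 0 < d by rewrite /d; lra.
  exists (Rmax 1 (- ln c / d)) => k hk.
  have k1 : 1 <= tau k by apply: Rle_trans hk; exact: Rmax_l.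
  have k2 : - ln c / d <= tau k by apply: Rle_trans hk; exact: Rmax_r.
  have h := hc k k1.
  have h1 : 0 < c * Rpower (rho - eps / 2) (tau k).
    by apply: Rmult_lt_0_compat => //; exact: exp_pos.
  apply: Rlt_le_trans (_ : rho - eps * (3 / 4) <= _); first lra.
  rewrite -[X in X <= _]exp_ln; last lra.
  apply: root_t_ge; [lra|lra|].
  apply: Rle_trans (ln_le_compat h1 h); rewrite ln_mult_Rpower; [|lra|lra].
  have := Rmult_le_compat_r _ _ _ (Rlt_le _ _ d0) k2.
  have -> : - ln c / d * d = - ln c by field; lra.
  rewrite {1}/d; lra.
exists (Rmax T1 T2) => k hk.
have := hT1 k (Rle_trans _ _ _ (Rmax_l _ _) hk).
have := hT2 k (Rle_trans _ _ _ (Rmax_r _ _) hk).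
by move=> *; apply: Rabs_def1; lra.
Qed.

(** * The discrete radius *)

Section Discrete.
Variables (n : nat).
Implicit Types (M N : mat n -> Prop).

Lemma sup_norm_ub (S : mat n -> Prop) c X :
  (forall A, S A -> mnorm A <= c) -> S X -> mnorm X <= sup_norm S.
Proof.
move=> hS SX; have [||ub _] := @Rsup_is_lub (fun r => exists A, S A /\ r = mnorm A) c.
- by exists (mnorm X), X.
- by move=> x [A [/hS ? ->]].
by apply: ub; exists X.
Qed.

Lemma sup_norm_le (S : mat n -> Prop) c :
  (exists A, S A) -> (forall A, S A -> mnorm A <= c) -> sup_norm S <= c.
Proof.
move=> [X SX] hS; have [||_ lst] := @Rsup_is_lub (fun r => exists A, S A /\ r = mnorm A) c.
- by exists (mnorm X), X.
- by move=> x [A [/hS ? ->]].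
by apply: lst => x [A [/hS ? ->]].
Qed.

Lemma sup_norm_ge0 (S : mat n -> Prop) c :
  (exists A, S A) -> (forall A, S A -> mnorm A <= c) -> 0 <= sup_norm S.
Proof.
by move=> [X SX] hS; apply: Rle_trans (mnorm_ge0 X) _; exact: sup_norm_ub hS SX.
Qed.

(** The existence of the limit chosen by [epsilon] is proved here too: Fekete's argument, in
    [is_rate_lower], bounds the supremum from below at every positive time. *)
Lemma jsr_disc_is_rate N c : 0 <= c -> (exists A, N A) -> (forall A, N A -> mnorm A <= c) ->
  is_rate N (jsr_disc N).
Proof.
move=> c0 Nn hN; have [rho rt] := is_rate_exists c0 hN.
suff cv : Un_cv (fun t => root_t (sup_norm (disc_St N t)) (INR t)) rho.
  suff -> : jsr_disc N = rho by [].
  have h := epsilon_spec (inhabits 0) _ (ex_intro _ rho cv).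
  exact: UL_sequence h cv.
have n0 := pos_INR n.
have bd t A : disc_St N t A -> mnorm A <= (INR n * c) ^ t by exact: disc_St_bound.
move=> eps eps0; have [| | | |T0 hT0] := @root_t_cvg nat INR (fun t => sup_norm (disc_St N t)) rho _ _ _ _ eps eps0.
- by case: rt.
- by move=> k _; apply: sup_norm_ge0 (bd k); exact: disc_St_nonempty.
- move=> q qr; exists (/ (INR n + 1)); split; first by apply: Rinv_0_lt_compat; lra.
  move=> k k1; have kp : (0 < k)%N by case: k k1 => //=; lra.
  rewrite Rpower_pow; last lra.
  have [X [hX qX]] := is_rate_lower c0 hN rt kp qr.
  apply: Rle_trans (sup_norm_ub (bd k) hX).
  apply: (Rmult_le_reg_l (INR n + 1)); first lra.
  by rewrite -Rmult_assoc Rinv_r ?Rmult_1_l //; lra.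
- move=> q rq; have [C hC] := rt.2.1 q rq; exists C => k k1.
  have q0 : 0 < q by have := rt.1; lra.
  rewrite Rpower_pow //; apply: sup_norm_le; first exact: disc_St_nonempty.
  exact: hC.
have [m hm] := INR_unbounded T0; exists m => t mt; apply: hT0.
by apply: Rle_trans (Rlt_le _ _ hm) _; exact: le_INR.
Qed.

Lemma loc_lipschitz_disc K : proper_cone K -> loc_lipschitz (P_disc K) (@jsr_disc n).
Proof.
move=> Kp M [piM [[[c hc] _] [Mn [B [MB irr]]]]].
have c0 : 0 <= c by have [A MA] := Mn; apply: Rle_trans (mnorm_ge0 A) (hc A MA).
have c10 : 0 <= c + 1 by lra.
have [d [L [dp [L0 hL]]]] := rate_loc_lipschitz Kp MB irr c10.
(* The [1] keeps [N1] and [N2] in the ball of radius [c + 1] for which [d] and [L] were chosen. *)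
exists (Rmin d 1), L; split; first by apply: Rmin_pos; lra.
split=> // N1 N2 P1 P2 H1 H2.
have bound N : P_disc K N -> hausdorff M N < Rmin d 1 ->
    close M N d /\ (forall A, N A -> mnorm A <= c + 1).
  move=> [_ [[[c' hc'] _] [Nn _]]] H.
  split.
    exact: (hausdorff_close hc hc' Mn Nn (Rlt_le_trans _ _ _ H (Rmin_l _ _))).1.
  apply: (close_bound hc).
  exact: (hausdorff_close hc hc' Mn Nn (Rlt_le_trans _ _ _ H (Rmin_r _ _))).2.
have [cl1 b1] := bound _ P1 H1; have [cl2 b2] := bound _ P2 H2.
have [pi1 [_ [n1 _]]] := P1; have [pi2 [_ [n2 _]]] := P2.
have rt1 := jsr_disc_is_rate c10 n1 b1; have rt2 := jsr_disc_is_rate c10 n2 b2.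
have h0 := hausdorff_ge0 b1 b2 n1 n2.
apply: le_of_forall_gt => // h hh; have hp : 0 <= h by lra.
have [c12 c21] := hausdorff_close b1 b2 n1 n2 hh.
have u1 := hL _ _ _ _ _ pi2 b2 cl2 hp c12 rt1 rt2.
have u2 := hL _ _ _ _ _ pi1 b1 cl1 hp c21 rt2 rt1.
by apply: Rabs_le; lra.
Qed.

End Discrete.

(** * The matrix exponential *)

Lemma is_series_ext_R (a b : nat -> R) (l : R) :
  (forall k, a k = b k) -> is_series a l -> is_series b l.
Proof. exact: is_series_ext. Qed.

Lemma is_series_rsum n (a : 'I_n -> nat -> R) (v : 'I_n -> R) :
  (forall l, is_series (a l) (v l)) ->
  is_series (fun k => \rsum_(l < n) a l k) (\rsum_(l < n) v l).
Proof.
move=> h; elim: (index_enum _) => [|l s IH].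
  apply: (@is_series_ext_R (fun k => 0)) => [k|]; first by rewrite big_nil.
  rewrite big_nil; apply/is_series_Reals => eps eps0; exists 0%N => k _.
  by rewrite sum_eq_R0 // R_dist_eq.
apply: (@is_series_ext_R (fun k => a l k + \big[Rplus/0]_(j <- s) a j k)) => [k|].
  by rewrite big_cons.
by rewrite big_cons; exact: is_series_plus (h l) IH.
Qed.

Lemma is_series_scal_R (a : nat -> R) l (c : R) : is_series a l -> is_series (fun k => c * a k) (c * l).
Proof. exact: is_series_scal. Qed.

Arguments is_series_scal_R {a l} c.

Lemma is_series_abs_le (a b : nat -> R) la lb : is_series a la -> is_series b lb ->
  (forall k, Rabs (a k) <= b k) -> Rabs la <= lb.
Proof.
move=> ha hb ab; rewrite -(is_series_unique _ _ ha) -(is_series_unique _ _ hb).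
have exb : ex_series b by exists lb.
have exa : ex_series (fun k => Rabs (a k)).
  apply: (ex_series_le (V := R_CompleteNormedModule)) exb => k.
  by rewrite /norm /= /abs /= Rabs_Rabsolu.
apply: Rle_trans (Series_Rabs _ exa) _; apply: Series_le => // k.
by split=> //; exact: Rabs_pos.
Qed.

Lemma is_series_exp x : is_series (fun k => x ^ k / INR (fact k)) (exp x).
Proof.
have /is_pseries_R := is_exp_Reals x; apply: is_series_ext_R => k.
by rewrite /Rdiv Rmult_comm.
Qed.

Arguments is_series_exp : clear implicits.

Lemma CV_radius_pinfty (a : nat -> R) x : (forall r, CV_disk a r) ->
  Rbar_lt (Rabs x) (CV_radius a).
Proof.
move=> h; have [ub _] := Lub_Rbar_correct (CV_disk a).
have := ub _ (h (Rabs x + 1)); rewrite -/(CV_radius a).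
by case: (CV_radius a) => //= r; lra.
Qed.

Section MatrixExponential.
Variable n : nat.
Implicit Types (A B X Y : mat n).

Lemma mpow_scale t A k : mpow (mscale t A) k = mscale (t ^ k) (mpow A k).
Proof.
elim: k => [|k IH] /=; first by apply: mat_ext => i j; rewrite /mscale; ring.
by rewrite IH mmulZl mmulZr; mring.
Qed.

Lemma left_bounded_mpow A c k : 0 <= c -> mnorm A <= c ->
  left_bounded ((INR n * c) ^ k) (mpow A k).
Proof.
move=> c0 Ac; have nc : 0 <= INR n * c by apply: Rmult_le_pos => //; exact: pos_INR.
elim: k => [|k IH]; first exact: left_bounded_id.
by apply: left_bounded_mul => //; exact: left_bounded_mnorm.
Qed.

Definition mexp_coef A (i j : 'I_n) (k : nat) := mpow A k i j / INR (fact k).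

Lemma mexp_coef_disk A i j r : CV_disk (mexp_coef A i j) r.
Proof.
have A0 := mnorm_ge0 A.
have ex : ex_series (fun k => (INR n * mnorm A * Rabs r) ^ k / INR (fact k)).
  by eexists; exact: is_series_exp.
apply: (ex_series_le (V := R_CompleteNormedModule)) ex => k.
rewrite /norm /= /abs /= Rabs_Rabsolu /mexp_coef /Rdiv !Rabs_mult Rpow_mult_distr -RPow_abs.
have f0 : 0 < / INR (fact k) by apply: Rinv_0_lt_compat; exact: INR_fact_lt_0.
rewrite (Rabs_pos_eq (/ _)); last lra.
have h : Rabs (mpow A k i j) <= (INR n * mnorm A) ^ k.
  apply: Rle_trans (mnorm_entry _ _ _) _; apply: mnorm_left_bounded.
    by apply: pow_le; apply: Rmult_le_pos => //; exact: pos_INR.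
  by apply: left_bounded_mpow => //; lra.
have r0 : 0 <= Rabs r ^ k by apply: pow_le; exact: Rabs_pos.
have := Rmult_le_compat_r _ _ _ (Rmult_le_pos _ _ (Rlt_le _ _ f0) r0) h; lra.
Qed.

(** Along a line, each entry of [mexp] is a real power series convergent everywhere;
    differentiability is inherited from it. *)
Lemma mexpE t A i j : mexp (mscale t A) i j = PSeries (mexp_coef A i j) t.
Proof.
have cv : Un_cv (fun N => sum_f_R0 (fun k => mpow (mscale t A) k i j / INR (fact k)) N)
    (PSeries (mexp_coef A i j) t).
  apply/is_series_Reals.
  have /PSeries_correct/is_pseries_R := CV_radius_inside _ _ (CV_radius_pinfty t (mexp_coef_disk A i j)).
  by apply: is_series_ext_R => k; rewrite mpow_scale /mexp_coef /mscale /Rdiv; ring.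
exact: UL_sequence (epsilon_spec (inhabits 0) _ (ex_intro _ _ cv)) cv.
Qed.

Lemma mexp_series t A i j :
  is_series (fun k => mpow A k i j * (t ^ k / INR (fact k))) (mexp (mscale t A) i j).
Proof.
rewrite mexpE.
have /PSeries_correct/is_pseries_R := CV_radius_inside _ _ (CV_radius_pinfty t (mexp_coef_disk A i j)).
by apply: is_series_ext_R => k; rewrite /mexp_coef /Rdiv; ring.
Qed.

Arguments mexp_series : clear implicits.

Lemma mexp_mul_series t A X i j :
  is_series (fun k => mmul (mpow A k) X i j * (t ^ k / INR (fact k)))
    (mmul (mexp (mscale t A)) X i j).
Proof.
have -> : mmul (mexp (mscale t A)) X i j = \rsum_(l < n) (X l j * mexp (mscale t A) i l).
  by apply: eq_bigr => l _; ring.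
apply: is_series_ext_R (is_series_rsum (fun l => is_series_scal_R (X l j) (mexp_series t A i l))) => k.
rewrite /mmul (Rmult_comm (\big[_/_]_(_ < _) _)).
by rewrite rsum_scale; apply: eq_bigr => l _; ring.
Qed.

Arguments mexp_mul_series : clear implicits.

Lemma mul_mexp_series t A X i j :
  is_series (fun k => mmul X (mpow A k) i j * (t ^ k / INR (fact k)))
    (mmul X (mexp (mscale t A)) i j).
Proof.
apply: is_series_ext_R (is_series_rsum (fun l => is_series_scal_R (X i l) (mexp_series t A l j))) => k.
rewrite /mmul (Rmult_comm (\big[_/_]_(_ < _) _)).
by rewrite rsum_scale; apply: eq_bigr => l _; ring.
Qed.

Arguments mul_mexp_series : clear implicits.

Lemma mexp0 A : mexp (mscale 0 A) = @mid n.
Proof.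
apply: mat_ext => i j; rewrite mexpE PSeries_0 /mexp_coef /=; field.
Qed.

Lemma left_bounded_mexp t A c : 0 <= c -> mnorm A <= c ->
  left_bounded (exp (INR n * c * Rabs t)) (mexp (mscale t A)).
Proof.
move=> c0 Ac X; have X0 := mnorm_ge0 X.
apply: mnorm_le => [|i j]; first by apply: Rmult_le_pos => //; apply: Rlt_le; exact: exp_pos.
rewrite Rmult_comm.
apply: is_series_abs_le (mexp_mul_series t A X i j)
  (is_series_scal_R _ (is_series_exp (INR n * c * Rabs t))) _ => k.
rewrite !Rabs_mult -RPow_abs Rpow_mult_distr.
have f0 : 0 < / INR (fact k) by apply: Rinv_0_lt_compat; exact: INR_fact_lt_0.
rewrite (Rabs_pos_eq (/ _)); last lra.
have r0 : 0 <= Rabs t ^ k by apply: pow_le; exact: Rabs_pos.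
have h : Rabs (mmul (mpow A k) X i j) <= (INR n * c) ^ k * mnorm X.
  by apply: Rle_trans (mnorm_entry _ _ _) _; exact: left_bounded_mpow.
have := Rmult_le_compat_r _ _ _ (Rmult_le_pos _ _ (Rlt_le _ _ f0) r0) h; rewrite /Rdiv; lra.
Qed.

Lemma mexp_deriv_series A i j s l : is_series (fun k => mpow A k.+1 i j * (s ^ k / INR (fact k))) l ->
  derivable_pt_lim (fun u => mexp (mscale u A) i j) s l.
Proof.
move=> h; apply/is_derive_Reals.
apply: (is_derive_ext (PSeries (mexp_coef A i j))) => [u|]; first by rewrite mexpE.
have := is_derive_PSeries _ _ (CV_radius_pinfty s (mexp_coef_disk A i j)).
suff -> : PSeries (PS_derive (mexp_coef A i j)) s = l by [].
apply: is_pseries_unique; apply/is_pseries_R; apply: is_series_ext_R h => k.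
rewrite /PS_derive /mexp_coef fact_simpl mult_INR.
field; split; apply: Rgt_not_eq; [exact: INR_fact_lt_0|apply: lt_0_INR; lia].
Qed.

Lemma mderiv_mexp A s :
  mderiv_at (fun u => mexp (mscale u A)) s (mmul A (mexp (mscale s A))).
Proof. by move=> i j; apply: mexp_deriv_series; exact: (mul_mexp_series s A A i j). Qed.

Arguments mderiv_mexp : clear implicits.

Lemma mexp_comm A s : mmul A (mexp (mscale s A)) = mmul (mexp (mscale s A)) A.
Proof.
apply: mat_ext => i j.
rewrite -(is_series_unique _ _ (mul_mexp_series s A A i j)).
apply: is_series_unique; apply: is_series_ext_R (mexp_mul_series s A A i j) => k.
by rewrite -mpowSr.
Qed.

Lemma derivable_pt_lim_rsum (F : 'I_n -> R -> R) (D : 'I_n -> R) s :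
  (forall l, derivable_pt_lim (F l) s (D l)) ->
  derivable_pt_lim (fun u => \rsum_(l < n) F l u) s (\rsum_(l < n) D l).
Proof.
move=> h; elim: (index_enum _) => [|l r IH].
  rewrite big_nil; apply: (derivable_pt_lim_ext (fun=> 0)) => [u|]; first by rewrite big_nil.
  exact: derivable_pt_lim_const.
rewrite big_cons.
apply: (derivable_pt_lim_ext (fun u => F l u + \big[Rplus/0]_(j <- r) F j u)) => [u|].
  by rewrite big_cons.
exact: derivable_pt_lim_plus (h l) IH.
Qed.

Lemma mderiv_mul (F G : R -> mat n) s F' G' : mderiv_at F s F' -> mderiv_at G s G' ->
  mderiv_at (fun u => mmul (F u) (G u)) s (madd (mmul F' (G s)) (mmul (F s) G')).
Proof.
move=> hF hG i j; rewrite /madd /mmul -big_split.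
apply: derivable_pt_lim_rsum => l; exact: derivable_pt_lim_mult (hF i l) (hG l j).
Qed.

Lemma mderiv_const A s : mderiv_at (fun=> A) s (@mzero n).
Proof. by move=> i j; exact: derivable_pt_lim_const. Qed.

Lemma mderiv_affine (F : R -> mat n) a b s F' : mderiv_at F (a + b * s) F' ->
  mderiv_at (fun u => F (a + b * u)) s (mscale b F').
Proof.
move=> h i j; rewrite /mscale Rmult_comm.
apply: (derivable_pt_lim_comp (fun u => a + b * u) (fun u => F u i j)) => //.
rewrite -[b in derivable_pt_lim _ _ b]Rplus_0_l.
apply: derivable_pt_lim_plus; first exact: derivable_pt_lim_const.
rewrite -[b in derivable_pt_lim _ _ b]Rmult_1_r.
by apply: derivable_pt_lim_scal; exact: derivable_pt_lim_id.
Qed.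

Lemma mderiv_add (F G : R -> mat n) s F' G' : mderiv_at F s F' -> mderiv_at G s G' ->
  mderiv_at (fun u => madd (F u) (G u)) s (madd F' G').
Proof. by move=> hF hG i j; exact: derivable_pt_lim_plus (hF i j) (hG i j). Qed.

Lemma mderiv_opp (F : R -> mat n) s F' : mderiv_at F s F' ->
  mderiv_at (fun u => mopp (F u)) s (mopp F').
Proof. by move=> hF i j; exact: derivable_pt_lim_opp (hF i j). Qed.

Lemma mean_value_mdist (F F' : R -> mat n) a b c : a <= b -> 0 <= c ->
  (forall u, a <= u <= b -> mderiv_at F u (F' u)) ->
  (forall u, a <= u <= b -> mnorm (F' u) <= c) -> mdist (F b) (F a) <= c * (b - a).
Proof.
move=> ab c0 hd hc; have ba : 0 <= b - a by lra.
apply: mnorm_le => [|i j]; first exact: Rmult_le_pos.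
case: ab => [ab|<-]; last by rewrite /madd /mopp Rplus_opp_r Rabs_R0; apply: Rmult_le_pos; lra.
have [u [e hu]] := @MVT_cor2 (fun u => F u i j) (fun u => F' u i j) a b ab (fun u hu => hd u hu i j).
rewrite /madd /mopp -/(F b i j - F a i j) e Rabs_mult (Rabs_pos_eq (b - a)) //.
apply: Rmult_le_compat_r => //; apply: Rle_trans (mnorm_entry _ _ _) _; apply: hc; lra.
Qed.

Lemma mdist_eq0 A B : mdist A B <= 0 -> A = B.
Proof.
move=> h; apply: mat_ext => i j; have := mnorm_entry (madd A (mopp B)) i j.
rewrite -/(mdist A B) /madd /mopp => h'; have := Rabs_pos (A i j + - B i j) => h0.
by have : A i j + - B i j = 0; [case: (Req_dec (A i j + - B i j) 0) => // /Rabs_no_R0|]; lra.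
Qed.

Lemma mderiv_zero_const (F : R -> mat n) a b :
  (forall u, mderiv_at F u (@mzero n)) -> F b = F a.
Proof.
move=> h; have z : mnorm (@mzero n) <= 0.
  by apply: mnorm_le => [|i j]; rewrite /mzero ?Rabs_R0; lra.
case: (Rle_dec a b) => ab; [|symmetry]; apply: mdist_eq0.
  have := @mean_value_mdist F (fun=> @mzero n) a b 0 ab (Rle_refl _) (fun u _ => h u) (fun _ _ => z); lra.
have ba : b <= a by lra.
have := @mean_value_mdist F (fun=> @mzero n) b a 0 ba (Rle_refl _) (fun u _ => h u) (fun _ _ => z); lra.
Qed.

(** The path [exp(-u A) exp((s + u) A)] has zero derivative and equals [exp(s A)] at [u = 0]. The
    unsimplified arguments have the shape [a + b * u] of [mderiv_affine]. *)
Lemma mexp_add_aux A s t :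
  mmul (mexp (mscale (0 + -1 * t) A)) (mexp (mscale (s + 1 * t) A)) = mexp (mscale s A).
Proof.
pose F u := mmul (mexp (mscale (0 + -1 * u) A)) (mexp (mscale (s + 1 * u) A)).
rewrite -/(F t) (@mderiv_zero_const F 0 t) => [|u].
  by rewrite /F !Rmult_0_r !Rplus_0_r mexp0 mmul1l.
have := mderiv_mul (mderiv_affine (mderiv_mexp A (0 + -1 * u)))
  (mderiv_affine (mderiv_mexp A (s + 1 * u))).
congr mderiv_at; rewrite mmulZl mmulZr mexp_comm mmulA; mring.
Qed.

Lemma mexp_opp_mul A t : mmul (mexp (mscale (- t) A)) (mexp (mscale t A)) = @mid n.
Proof.
rewrite -(mexp0 A) -(mexp_add_aux A 0 t).
by congr mmul; congr mexp; mring.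
Qed.

Lemma mexp_mul_opp A t : mmul (mexp (mscale t A)) (mexp (mscale (- t) A)) = @mid n.
Proof. by have := mexp_opp_mul A (- t); rewrite Ropp_involutive. Qed.

Lemma mexp_add A s t :
  mexp (mscale (t + s) A) = mmul (mexp (mscale t A)) (mexp (mscale s A)).
Proof.
rewrite -(mexp_add_aux A s t) mmulA.
have -> : 0 + -1 * t = - t by ring.
by rewrite mexp_mul_opp mmul1l Rmult_1_l Rplus_comm.
Qed.

Lemma left_bounded_mexp_pos t A c : 0 <= c -> mnorm A <= c -> 0 <= t ->
  left_bounded (exp (INR n * c * t)) (mexp (mscale t A)).
Proof. by move=> c0 Ac t0; have := left_bounded_mexp t c0 Ac; rewrite Rabs_pos_eq. Qed.

(** Duhamel's interpolation: [exp((h - u) B) exp(u A)] joins the two exponentials and has derivative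
    [exp((h - u) B) (A - B) exp(u A)]. *)
Lemma mexp_mdist A B c h : 0 <= c -> mnorm A <= c -> mnorm B <= c -> 0 <= h ->
  mdist (mexp (mscale h A)) (mexp (mscale h B)) <= INR n * mdist A B * exp (INR n * c * h) * h.
Proof.
move=> c0 Ac Bc h0.
pose F u := mmul (mexp (mscale (h + -1 * u) B)) (mexp (mscale (0 + 1 * u) A)).
pose F' u := mmul (mexp (mscale (h + -1 * u) B))
   (mmul (madd A (mopp B)) (mexp (mscale (0 + 1 * u) A))).
have d0 := mdist_ge0 A B; have n0 := pos_INR n.
have E0 x := Rlt_le _ _ (exp_pos x).
have nd : 0 <= INR n * mdist A B by exact: Rmult_le_pos.
have hd u : 0 <= u <= h -> mderiv_at F u (F' u).
  move=> _; have := mderiv_mul (mderiv_affine (mderiv_mexp B (h + -1 * u)))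
    (mderiv_affine (mderiv_mexp A (0 + 1 * u))).
  congr mderiv_at; rewrite /F' mmulBl mmulBr mexp_comm mmulZl mmulZr mmulA.
  rewrite -!mmulA; mring.
have hc u : 0 <= u <= h -> mnorm (F' u) <= INR n * mdist A B * exp (INR n * c * h).
  move=> hu; have hu1 : 0 <= h + -1 * u by lra. have hu2 : 0 <= 0 + 1 * u by lra.
  apply: Rle_trans (left_bounded_mexp_pos c0 Bc hu1 _) _.
  have h2 := left_bounded_mnorm (Rle_refl (mdist A B)) (mexp (mscale (0 + 1 * u) A)).
  have h3 : mnorm (mexp (mscale (0 + 1 * u) A)) <= exp (INR n * c * (0 + 1 * u)).
    by apply: mnorm_left_bounded => //; exact: left_bounded_mexp_pos.
  have -> : INR n * c * h = INR n * c * (h + -1 * u) + INR n * c * (0 + 1 * u) by ring.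
  rewrite exp_plus; set a := exp (_ * (h + _)).
  rewrite (_ : _ * (a * _) = a * (INR n * mdist A B * exp (INR n * c * (0 + 1 * u)))); last by ring.
  apply: Rmult_le_compat_l; first exact: E0.
  by apply: Rle_trans h2 _; exact: Rmult_le_compat_l.
have := mean_value_mdist h0 (Rmult_le_pos _ _ nd (E0 _)) hd hc.
rewrite /F.
have -> : h + -1 * h = 0 by ring.
have -> : 0 + 1 * h = h by ring.
have -> : h + -1 * 0 = h by ring.
have -> : 0 + 1 * 0 = 0 by ring.
by rewrite !mexp0 mmul1l mmul1r Rminus_0_r.
Qed.

Lemma mexp_mdist_id A c h : 0 <= c -> mnorm A <= c -> 0 <= h ->
  mdist (mexp (mscale h A)) (@mid n) <= INR n * c * exp (INR n * c * h) * h.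
Proof.
move=> c0 Ac h0; have n0 := pos_INR n; have nc : 0 <= INR n * c by exact: Rmult_le_pos.
have E0 x := Rlt_le _ _ (exp_pos x).
rewrite -(mexp0 A) -[X in _ <= _ * X](Rminus_0_r h).
apply: (@mean_value_mdist (fun u => mexp (mscale u A)) (fun u => mmul A (mexp (mscale u A)))) => //.
- exact: Rmult_le_pos.
- by move=> u _; exact: mderiv_mexp.
move=> u hu; apply: Rle_trans (left_bounded_mnorm Ac _) _.
apply: Rmult_le_compat_l => //.
apply: Rle_trans (mnorm_left_bounded (E0 _) (left_bounded_mexp_pos c0 Ac hu.1)) _.
by apply: exp_le_compat; apply: Rmult_le_compat_l => //; lra.
Qed.

End MatrixExponential.

(** * Products of exponentials *)

Section ExponentialProducts.
Variable n : nat.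
Implicit Types (M N : mat n -> Prop) (A B X Y : mat n) (l : seq (R * mat n)).

Fixpoint eprod l : mat n :=
  if l is (h, A) :: l' then mmul (mexp (mscale h A)) (eprod l') else @mid n.

(** Values at time [t] of solutions for piecewise constant controls, the head of the list acting
    last. For [t >= 0] and [M] bounded and nonempty it is dense in [cont_St M t], and it replaces
    that set in the estimates. *)
Definition exp_St M (t : R) X := exists l,
  (forall p, List.In p l -> 0 <= fst p /\ M (snd p)) /\ wsum l = t /\ X = eprod l.

Lemma exp_St_nil M : exp_St M 0 (@mid n).
Proof. by exists [::]. Qed.

Lemma exp_St_cons M h A t X : 0 <= h -> M A -> exp_St M t X ->
  exp_St M (h + t) (mmul (mexp (mscale h A)) X).
Proof.
move=> h0 MA [l [hl [<- ->]]]; exists ((h, A) :: l); split=> //.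
by move=> p [<-|/hl].
Qed.

Lemma exp_St_ind M (P : R -> mat n -> Prop) : P 0 (@mid n) ->
  (forall h A t X, 0 <= h -> M A -> 0 <= t -> exp_St M t X -> P t X ->
    P (h + t) (mmul (mexp (mscale h A)) X)) ->
  forall t X, exp_St M t X -> 0 <= t /\ P t X.
Proof.
move=> P0 PS t X [l [hl [<- ->]]]; elim: l hl => [|[h A] l IH] hl /=; first by split; [lra|].
have [h0 MA] := hl (h, A) (or_introl erefl).
have hl' p : List.In p l -> 0 <= fst p /\ M (snd p) by move=> pl; apply: hl; right.
have [t0 Pt] := IH hl'; rewrite /= in h0 MA; split; first lra.
by apply: PS => //; exists l.
Qed.

Lemma exp_St_ge0 M t X : exp_St M t X -> 0 <= t.
Proof. by move=> /(@exp_St_ind M (fun _ _ => True) I (fun _ _ _ _ _ _ _ _ _ => I))[]. Qed.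

Lemma exp_St_mul M s t X Y : exp_St M s X -> exp_St M t Y -> exp_St M (s + t) (mmul X Y).
Proof.
move=> hX hY; move: s X hX.
suff h s X : exp_St M s X -> 0 <= s /\ exp_St M (s + t) (mmul X Y) by move=> s X /h[].
apply: (exp_St_ind (P := fun s X => exp_St M (s + t) (mmul X Y))).
  by rewrite Rplus_0_l mmul1l.
move=> h A s' X' h0 MA _ _ IH; rewrite Rplus_assoc -mmulA; exact: exp_St_cons.
Qed.

Lemma exp_St_exp M h A : 0 <= h -> M A -> exp_St M h (mexp (mscale h A)).
Proof.
move=> h0 MA; have := exp_St_cons h0 MA (exp_St_nil M).
by rewrite Rplus_0_r mmul1r.
Qed.

(** Lengths are taken off the head of the list; an exponential that straddles the cut is divided by
    [mexp_add]. *)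
Lemma exp_St_split M s t X : 0 <= s -> 0 <= t -> exp_St M (s + t) X ->
  exists Y Z, exp_St M s Y /\ exp_St M t Z /\ X = mmul Y Z.
Proof.
move=> s0 t0 [l [hl [wl ->]]]; elim: l s s0 hl wl => [|[h A] l IH] s s0 hl /= wl.
  exists (@mid n), (@mid n); rewrite mmul1l.
  have -> : s = 0 by lra. have -> : t = 0 by lra.
  by split; [|split=> //]; exact: exp_St_nil.
have [/= h0 MA] := hl (h, A) (or_introl erefl).
have hl' p : List.In p l -> 0 <= fst p /\ M (snd p) by move=> pl; apply: hl; right.
case: (Rle_dec h s) => hs.
  have [||Y [Z [hY [hZ ->]]]] := IH (s - h) _ hl' _; [lra|lra|].
  exists (mmul (mexp (mscale h A)) Y), Z; rewrite mmulA; split=> //.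
  by rewrite (_ : s = h + (s - h)); [exact: exp_St_cons|ring].
exists (mexp (mscale s A)), (mmul (mexp (mscale (h - s) A)) (eprod l)).
split; first exact: exp_St_exp.
split; last by rewrite mmulA -mexp_add; congr mmul; congr mexp; mring.
rewrite (_ : t = (h - s) + wsum l); last by lra.
by apply: exp_St_cons => //; [lra|exists l].
Qed.

Lemma left_bounded_exp_St M c t X : 0 <= c -> (forall A, M A -> mnorm A <= c) ->
  exp_St M t X -> left_bounded (exp (INR n * c * t)) X.
Proof.
move=> c0 hM; move: t X.
suff h t X : exp_St M t X -> 0 <= t /\ left_bounded (exp (INR n * c * t)) X by move=> t X /h[].
apply: (exp_St_ind (P := fun t X => left_bounded (exp (INR n * c * t)) X)).
  by rewrite Rmult_0_r exp_0; exact: left_bounded_id.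
move=> h A s Y h0 MA s0 _ IH; rewrite Rmult_plus_distr_l exp_plus.
apply: left_bounded_mul => //; first by apply: Rlt_le; exact: exp_pos.
by apply: left_bounded_mexp_pos => //; exact: hM.
Qed.

Lemma mnorm_exp_St M c t X : 0 <= c -> (forall A, M A -> mnorm A <= c) ->
  exp_St M t X -> mnorm X <= exp (INR n * c * t).
Proof.
move=> c0 hM hX; apply: mnorm_left_bounded; first by apply: Rlt_le; exact: exp_pos.
exact: left_bounded_exp_St hX.
Qed.

(** Replacing one factor costs an error proportional to its length, so the bound involves the total
    time but not the number of factors. *)
Lemma exp_St_close M N c d t X : 0 <= c -> (forall A, M A -> mnorm A <= c) ->
  (forall A, N A -> mnorm A <= c) -> 0 <= d -> close M N d -> exp_St M t X ->
  exists Y, exp_St N t Y /\ mdist X Y <= INR n * INR n * d * t * exp (INR n * c * t).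
Proof.
move=> c0 hM hN d0 cl; have n0 := pos_INR n.
have E0 x := Rlt_le _ _ (exp_pos x).
have nc : 0 <= INR n * c by exact: Rmult_le_pos.
move: t X; suff h t X : exp_St M t X -> 0 <= t /\ exists Y, exp_St N t Y /\
    mdist X Y <= INR n * INR n * d * t * exp (INR n * c * t) by move=> t X /h[].
apply: (exp_St_ind (P := fun t X => exists Y, exp_St N t Y /\
    mdist X Y <= INR n * INR n * d * t * exp (INR n * c * t))).
  by exists (@mid n); split; [exact: exp_St_nil|rewrite mdist_refl; lra].
move=> h A s Y h0 MA s0 hY [Z [hZ YZ]]; have [B [NB AB]] := cl A MA.
exists (mmul (mexp (mscale h B)) Z); split; first exact: exp_St_cons.
have -> : mdist (mmul (mexp (mscale h A)) Y) (mmul (mexp (mscale h B)) Z) =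
  mnorm (madd (mmul (mexp (mscale h B)) (madd Y (mopp Z)))
    (mmul (madd (mexp (mscale h A)) (mopp (mexp (mscale h B)))) Y)).
  by rewrite /mdist mmulBr mmulBl; congr mnorm; mring.
apply: Rle_trans (mnorm_add _ _) _.
have h1 := left_bounded_mexp_pos c0 (hN B NB) h0 (madd Y (mopp Z)).
have h2 := Rmult_le_compat_l _ _ _ (E0 (INR n * c * h)) YZ.
have h3 : mnorm (mmul (madd (mexp (mscale h A)) (mopp (mexp (mscale h B)))) Y) <=
    INR n * (INR n * d * exp (INR n * c * h) * h) * exp (INR n * c * s).
  apply: Rle_trans (mnorm_mul _ _) _; apply: Rmult_le_compat => //.
  - by apply: Rmult_le_pos => //; exact: mnorm_ge0.
  - exact: mnorm_ge0.
  - apply: Rmult_le_compat_l => //.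
    apply: Rle_trans (mexp_mdist c0 (hM A MA) (hN B NB) h0) _.
    do 2 apply: Rmult_le_compat_r => //.
    by apply: Rmult_le_compat_l => //; lra.
  - exact: mnorm_exp_St hY.
rewrite (_ : INR n * c * (h + s) = INR n * c * h + INR n * c * s); last by ring.
rewrite exp_plus /mdist in h2 *; lra.
Qed.

Lemma exp_St_in_pi K M t X : (forall A, M A -> in_pi_exp K A) -> exp_St M t X -> in_pi K X.
Proof.
move=> hM; move: t X; suff h t X : exp_St M t X -> 0 <= t /\ in_pi K X by move=> t X /h[].
apply: (exp_St_ind (P := fun t X => in_pi K X)); first exact: in_pi_id.
move=> h A s Y h0 MA _ _ IH; apply: in_pi_mul => //; exact: (hM A MA).
Qed.

(** At multiples of [t], exponential products form the discrete semigroup generated by those of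
    length [t]; the discrete results carry over through this. *)
Lemma disc_St_exp_St M t k X : 0 <= t ->
  disc_St (exp_St M t) k X <-> exp_St M (INR k * t) X.
Proof.
move=> t0; elim: k X => [|k IH] X.
  rewrite /= Rmult_0_l; split=> [->|]; first exact: exp_St_nil.
  move=> [l [hl [wl ->]]]; elim: l hl wl => [//|[h A] l IH] hl /= wl.
  have [/= h0 MA] := hl (h, A) (or_introl erefl).
  have hl' p : List.In p l -> 0 <= fst p /\ M (snd p) by move=> pl; apply: hl; right.
  have w0 : 0 <= wsum l by apply: (@exp_St_ge0 M _ (eprod l)); exists l.
  have -> : h = 0 by lra.
  by rewrite mexp0 mmul1l; apply: IH => //; lra.
have e : INR k.+1 * t = t + INR k * t by rewrite S_INR; ring.
rewrite e; split=> [[A [P [hA [/IH hP ->]]]]|]; first exact: exp_St_mul.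
move=> /(exp_St_split t0 (Rmult_le_pos _ _ (pos_INR k) t0))[Y [Z [hY [/IH hZ ->]]]].
by exists Y, Z.
Qed.

End ExponentialProducts.

(** * Solutions for piecewise constant controls *)

Section PiecewiseConstant.
Variable n : nat.
Implicit Types (M N : mat n -> Prop) (A B X Y : mat n).

Lemma lipschitz_abs_cont (Phi : R -> mat n) t L : 0 <= L ->
  (forall a b, 0 <= a -> a <= b -> b <= t -> mdist (Phi b) (Phi a) <= L * (b - a)) ->
  abs_cont_on Phi t.
Proof.
move=> L0 lip eps eps0; have L1 : 0 < L + 1 by lra.
exists (eps / (L + 1)); split; first exact: Rdiv_lt_0_compat.
move=> m a b hab _ hs.
apply: Rle_lt_trans (_ : L * (\rsum_(k < m) (b k - a k)) < eps).
  rewrite rsum_scale; apply: rsum_le => k; have [? [? ?]] := hab k (ltn_ord k); exact: lip.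
apply: Rle_lt_trans (_ : L * (eps / (L + 1)) < _).
  by apply: Rmult_le_compat_l => //; lra.
have e1 : 0 < eps / (L + 1) by exact: Rdiv_lt_0_compat.
have : (L + 1) * (eps / (L + 1)) = eps by field; lra.
lra.
Qed.

Lemma null_set_finite (l : seq R) : null_set (fun s => List.In s l).
Proof.
(* Half-widths: the lengths [2 * w k] sum to less than [eps]. Past the end of the list [nth] returns
   [0], and the later intervals just surround [0]. *)
move=> eps eps0; pose w k := eps * (1 / 2) ^ k / 4.
have w0 k : 0 < w k.
  rewrite /w; have : 0 < (1 / 2) ^ k by apply: pow_lt; lra.
  by move=> /(Rmult_lt_0_compat _ _ eps0); lra.
exists (fun k => nth 0 l k - w k), (fun k => nth 0 l k + w k); split; [|split].
- move=> x xl; suff [k <-] : exists k, nth 0 l k = x by exists k; have := w0 k; lra.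
  elim: l xl => // y l IH [->|/IH[k <-]]; first by exists 0%N.
  by exists k.+1.
- by move=> k; have := w0 k; lra.
move=> N; suff -> : sum_f_R0 (fun k => nth 0 l k + w k - (nth 0 l k - w k)) N =
    eps * (1 - (1 / 2) ^ N.+1).
  have : 0 < (1 / 2) ^ N.+1 by apply: pow_lt; lra.
  by move=> /(Rmult_lt_0_compat _ _ eps0); lra.
elim: N => [|N IH]; first by rewrite /w /=; field.
by rewrite tech5 IH /w /=; field.
Qed.

Lemma null_set_sub (E F : R -> Prop) : (forall x, E x -> F x) -> null_set F -> null_set E.
Proof.
move=> EF h eps /h[a [b [cov rest]]]; exists a, b; split=> // x /EF; exact: cov.
Qed.

(** A strengthening of [cont_St] that is easy to concatenate: [L]-Lipschitz instead of absolutely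
    continuous, and a finite list [l] of exceptional times instead of a null set. *)
Definition piecewise_solution M t X := exists (sigma Phi : R -> mat n) (l : seq R) L,
  0 <= L /\ (forall s, 0 <= s <= t -> M (sigma s)) /\ Phi 0 = @mid n /\
  (forall a b, 0 <= a -> a <= b -> b <= t -> mdist (Phi b) (Phi a) <= L * (b - a)) /\
  (forall s, 0 < s < t -> ~ List.In s l -> mderiv_at Phi s (mmul (sigma s) (Phi s))) /\
  X = Phi t.

Lemma piecewise_solution_cont_St M t X : piecewise_solution M t X -> cont_St M t X.
Proof.
move=> [sigma [Phi [l [L [L0 [hs [P0 [lip [hd ->]]]]]]]]]; exists sigma, Phi.
do 2 split=> //; split; first exact: lipschitz_abs_cont L0 lip.
split=> //; apply: null_set_sub (null_set_finite l) => s [st nd].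
by apply: NNPP => ns; apply: nd; exact: hd.
Qed.

Lemma piecewise_solution_step M t X h A : 0 <= t -> 0 <= h -> M A ->
  piecewise_solution M t X -> piecewise_solution M (h + t) (mmul (mexp (mscale h A)) X).
Proof.
move=> t0 h0 MA [sigma [Phi [l [L [L0 [hs [P0 [lip [hd ->]]]]]]]]].
(* The flow of [A] through [Phi t] at time [t], defined on the whole line and hence differentiable
   on both sides of the junction. *)
pose Psi u := mmul (mexp (mscale (- t + 1 * u) A)) (Phi t).
have Psid u : mderiv_at Psi u (mmul A (Psi u)).
  have := mderiv_mul (mderiv_affine (mderiv_mexp A (- t + 1 * u))) (mderiv_const (Phi t) u).
  congr mderiv_at; rewrite /Psi mmul0r mmulZl -mmulA; mring.
have Psit : Psi t = Phi t.
  by rewrite /Psi (_ : - t + 1 * t = 0); [rewrite mexp0 mmul1l|ring].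
have A0 := mnorm_ge0 A; have n0 := pos_INR n.
have E0 x := Rlt_le _ _ (exp_pos x).
have nA : 0 <= INR n * mnorm A by exact: Rmult_le_pos.
pose L1 := INR n * mnorm A * (exp (INR n * mnorm A * h) * mnorm (Phi t)).
have L10 : 0 <= L1.
  by apply: Rmult_le_pos => //; apply: Rmult_le_pos => //; exact: mnorm_ge0.
have Psil a b : t <= a -> a <= b -> b <= h + t -> mdist (Psi b) (Psi a) <= L1 * (b - a).
  move=> ta ab bt.
  apply: (@mean_value_mdist _ _ (fun u => mmul A (Psi u))) => // u hu.
  apply: Rle_trans (left_bounded_mnorm (Rle_refl _) _) _.
  apply: Rmult_le_compat_l => //.
  have u0 : 0 <= - t + 1 * u by lra.
  apply: Rle_trans (left_bounded_mexp_pos A0 (Rle_refl _) u0 _) _.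
  apply: Rmult_le_compat_r; first exact: mnorm_ge0.
  by apply: exp_le_compat; apply: Rmult_le_compat_l => //; lra.
pose Phi' u := if Rle_dec u t then Phi u else Psi u.
have Phi'l u : u <= t -> Phi' u = Phi u by rewrite /Phi'; case: Rle_dec.
have Phi'r u : t <= u -> Phi' u = Psi u.
  rewrite /Phi'; case: Rle_dec => //= ut tu.
  by have -> : u = t by lra.
(* The junction [t] becomes exceptional, since the two pieces may meet there with different
   slopes. *)
exists (fun u => if Rle_dec u t then sigma u else A), Phi', (t :: l), (Rmax L L1).
have LM := Rmax_l L L1; have L1M := Rmax_r L L1.
split; first by lra.
split.
  by move=> s hs'; case: Rle_dec => //= st; apply: hs; lra.
split; first by rewrite Phi'l.
split.
  move=> a b a0 ab bt.
  have ba : 0 <= b - a by lra.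
  case: (Rle_dec b t) => hb.
    rewrite !Phi'l //; last lra.
    by apply: Rle_trans (lip a b a0 ab hb) _; exact: Rmult_le_compat_r.
  case: (Rle_dec t a) => ha.
    rewrite !Phi'r //; last lra.
    by apply: Rle_trans (Psil a b ha ab bt) _; exact: Rmult_le_compat_r.
  rewrite Phi'r ?(Phi'l a); [|lra|lra].
  apply: Rle_trans (mdist_triangle (Psi t) _ _) _; rewrite {2}Psit.
  have h1 : mdist (Psi b) (Psi t) <= L1 * (b - t) by apply: Psil; lra.
  have h2 : mdist (Phi t) (Phi a) <= L * (t - a) by apply: lip; lra.
  have tb : 0 <= b - t by lra. have at' : 0 <= t - a by lra.
  have := Rmult_le_compat_r _ _ _ tb L1M; have := Rmult_le_compat_r _ _ _ at' LM; lra.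
split; last by rewrite Phi'r ?/Psi; [congr mmul; congr mexp; mring|lra].
move=> s hs' nl; have st : s <> t by move=> e; apply: nl; left.
case: Rle_dec => /= h1 i j.
  rewrite Phi'l //; apply: (@derivable_pt_lim_locally_ext (fun u => Phi u i j) _ _ (s - 1) t).
  - lra.
  - by move=> z hz; rewrite Phi'l //; lra.
  by apply: hd; [lra|move=> sl; apply: nl; right].
rewrite Phi'r; last lra.
apply: (@derivable_pt_lim_locally_ext (fun u => Psi u i j) _ _ t (s + 1)).
- lra.
- by move=> z hz; rewrite Phi'r //; lra.
exact: Psid.
Qed.

Lemma exp_St_cont_St M t X : (exists A, M A) -> exp_St M t X -> cont_St M t X.
Proof.
move=> [A0 MA0] hX; apply: piecewise_solution_cont_St; move: t X hX.
suff h t X : exp_St M t X -> 0 <= t /\ piecewise_solution M t X by move=> t X /h[].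
apply: (exp_St_ind (P := fun t X => piecewise_solution M t X)); last first.
  by move=> h A s Y h0 MA s0 _; exact: piecewise_solution_step.
exists (fun=> A0), (fun=> @mid n), [::], 0; split; first lra.
do 2 split=> //; split; first by move=> a b *; rewrite mdist_refl; lra.
by split=> // s hs; lra.
Qed.

End PiecewiseConstant.

(** * Approximation of Caratheodory solutions *)

(* Cousin's lemma, phrased as an induction principle on [[0, t]]. *)
Lemma gauge_induction t (P : R -> Prop) : 0 <= t -> P 0 ->
  (forall s, 0 <= s <= t -> exists d, 0 < d /\ forall x y,
     0 <= x -> x <= s -> s <= y -> y <= t -> s - d < x -> y < s + d -> P x -> P y) ->
  P t.
Proof.
move=> t0 P0 step; pose E x := 0 <= x <= t /\ P x.
have [||s [ub lst]] := @completeness E; first by exists t => x []; lra.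
  by exists 0; split; [lra|].
have E0 : E 0 by split; [lra|].
have s0 := ub _ E0; have st : s <= t by apply: lst => x []; lra.
have [d [d0 hd]] := step s (conj s0 st).
have [x [[xt Px] sx]] : exists x, E x /\ s - d < x.
  apply: NNPP => nx; have : s <= s - d; last lra.
  by apply: lst => x Ex; apply: Rnot_lt_le => h; apply: nx; exists x.
have xs : x <= s by apply: ub.
have Py : P (Rmin t (s + d / 2)).
  have := Rmin_l t (s + d / 2); have := Rmin_r t (s + d / 2) => ? ?.
  apply: (hd x) => //; try lra.
  by apply: Rmin_glb; lra.
case: (Rle_dec t (s + d / 2)) => h; first by rewrite Rmin_left in Py.
rewrite Rmin_right in Py; last lra.
have : s + d / 2 <= s; last lra.
by apply: ub; split=> //; lra.
Qed.

(** * Length swept in a cover of the exceptional times *)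

Definition clip a b x := Rmin (Rmax x a) b.

Lemma clip_le a b x y : x <= y -> clip a b x <= clip a b y.
Proof. by move=> xy; apply: Rle_min_compat_r; exact: Rle_max_compat_r. Qed.

Lemma clip_bounds a b x : a <= b -> a <= clip a b x <= b.
Proof.  by move=> ab; split; [apply: Rmin_glb => //; exact: Rmax_r|exact: Rmin_r]. Qed.

Lemma clip_id a b x : a < x < b -> clip a b x = x.
Proof. by move=> ab; rewrite /clip Rmax_left ?Rmin_left; lra. Qed.

Section CoverLength.
Variables (a b : nat -> R).

(* Length of the part of the first [J + 1] covering intervals in [[0, x]], with
   multiplicity. *)
Definition cover_len J x := sum_f_R0 (fun j => clip (a j) (b j) x - clip (a j) (b j) 0) J.

Lemma cover_lenS J x :
  cover_len J.+1 x = cover_len J x + (clip (a J.+1) (b J.+1) x - clip (a J.+1) (b J.+1) 0).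
Proof. by []. Qed.

Lemma cover_len_mono J x y : x <= y -> cover_len J x <= cover_len J y.
Proof. by move=> xy; apply: sum_Rle => j _; have := clip_le (a j) (b j) xy; lra. Qed.

Lemma cover_len_ge0 J x : 0 <= x -> 0 <= cover_len J x.
Proof.
move=> x0; apply: cond_pos_sum => j; have := clip_le (a j) (b j) x0; lra.
Qed.

Lemma cover_len_widen J J' x : 0 <= x -> (J <= J')%N -> cover_len J x <= cover_len J' x.
Proof.
move=> x0; elim: J' => [|J' IH]; first by rewrite leqn0 => /eqP->; lra.
rewrite leq_eqVlt => /orP[/eqP->|]; first lra.
rewrite ltnS => /IH; rewrite cover_lenS.
by have := clip_le (a J'.+1) (b J'.+1) x0; lra.
Qed.

(** The [j]-th covering interval contains [[x, y]], so its term grows by exactly [y - x], and no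
    other term decreases. *)
Lemma cover_len_step J j x y : (j <= J)%N -> x <= y -> a j < x -> y < b j ->
  cover_len J x + (y - x) <= cover_len J y.
Proof.
move=> jJ xy ax yb; elim: J jJ => [|J IH].
  rewrite leqn0 => /eqP j0; rewrite /cover_len /= -j0 (clip_id (x := x)) ?(clip_id (x := y)); lra.
rewrite !cover_lenS leq_eqVlt => /orP[/eqP j0|].
  rewrite -j0 (clip_id (x := x)) ?(clip_id (x := y)); try lra.
  by have := cover_len_mono J xy; lra.
by rewrite ltnS => /IH; have := clip_le (a J.+1) (b J.+1) xy; lra.
Qed.

Lemma cover_len_le J x : (forall k, a k <= b k) ->
  cover_len J x <= sum_f_R0 (fun k => b k - a k) J.
Proof.
move=> ab; apply: sum_Rle => j _.
by have := clip_bounds x (ab j); have := clip_bounds 0 (ab j); lra.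
Qed.

End CoverLength.

(** Serves to add the end points [0] and [t], where [cont_St] says nothing about the derivative. *)
Lemma null_set_add (E : R -> Prop) p : null_set E -> null_set (fun x => E x \/ x = p).
Proof.
move=> nE eps eps0; have [|a [b [cov [ab len]]]] := nE (eps / 2); first lra.
exists (fun k => if k is k'.+1 then a k' else p - eps / 4).
exists (fun k => if k is k'.+1 then b k' else p + eps / 4); split; [|split].
- move=> x [/cov[k hk]|->]; first by exists k.+1.
  by exists 0%N; lra.
- by case=> [|k]; [lra|exact: ab].
case=> [|N]; first by rewrite /=; lra.
by rewrite decomp_sum /=; [have := len N; lra|lia].
Qed.

Lemma mderiv_zero_small n (g : R -> mat n) s eps : mderiv_at g s (@mzero n) -> g s = @mzero n ->
  0 < eps -> exists d, 0 < d /\ forall u, Rabs (u - s) < d -> mnorm (g u) <= eps * Rabs (u - s).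
Proof.
move=> hg gs eps0.
have one i j : exists d, 0 < d /\ forall u, Rabs (u - s) < d -> Rabs (g u i j) <= eps * Rabs (u - s).
  have [d hd] := hg i j eps eps0; exists d; split; first exact: cond_pos.
  move=> u us; case: (Req_dec u s) => [->|un].
    by rewrite gs /mzero /Rminus Rplus_opp_r Rabs_R0; lra.
  have u0 : u - s <> 0 by lra.
  have := hd _ u0 us; rewrite (_ : s + (u - s) = u) ?gs /mzero ?Rminus_0_r; last by ring.
  rewrite /Rdiv Rabs_mult Rabs_inv => /Rlt_le.
  have ua := Rabs_pos_lt _ u0.
  move=> /(Rmult_le_compat_r _ _ _ (Rlt_le _ _ ua)); rewrite Rmult_assoc Rinv_l; lra.
have all (S : seq ('I_n * 'I_n)) : exists d, 0 < d /\ forall p, p \in S ->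
    forall u, Rabs (u - s) < d -> Rabs (g u p.1 p.2) <= eps * Rabs (u - s).
  elim: S => [|[i j] S [d1 [d10 h1]]]; first by exists 1; split; [lra|].
  have [d2 [d20 h2]] := one i j; exists (Rmin d1 d2); split; first exact: Rmin_pos.
  move=> p; rewrite inE => /orP[/eqP->|pS] u us.
    by apply: h2; apply: Rlt_le_trans us (Rmin_r _ _).
  by apply: h1 => //; apply: Rlt_le_trans us (Rmin_l _ _).
have [d [d0 hd]] := all (enum {: 'I_n * 'I_n}).
exists d; split=> // u us; apply: mnorm_le => [|i j].
  by apply: Rmult_le_pos; [lra|exact: Rabs_pos].
by apply: (hd (i, j)) => //; rewrite mem_enum.
Qed.

(** * The gauge argument *)

Section Approximation.
Variables (n : nat) (M : mat n -> Prop) (c t : R) (sigma Phi : R -> mat n).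
Hypotheses (c0 : 0 <= c) (hM : forall A, M A -> mnorm A <= c) (t0 : 0 <= t).
Hypothesis sigmaM : forall s, 0 <= s <= t -> M (sigma s).

(** [exp (kappa * h)] bounds multiplication by an exponential of length [h], and [Ct] is its value
    for the whole interval. [C'] is a displacement rate: [|exp(h A) X - X| <= C' * h] for the
    products [X] that occur. *)
Let kappa := INR n * c.
Let Ct := exp (kappa * t).
Let C' := INR n * (kappa * Ct) * Ct.

Lemma kappa_ge0 : 0 <= kappa.
Proof. by apply: Rmult_le_pos => //; exact: pos_INR. Qed.

Lemma exp_kappa_ge1 x : 0 <= x -> 1 <= exp (kappa * x).
Proof.
move=> x0; rewrite -exp_0; apply: exp_le_compat; exact: Rmult_le_pos kappa_ge0 x0.
Qed.

Lemma exp_kappa_le x : x <= t -> exp (kappa * x) <= Ct.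
Proof. by move=> xt; apply: exp_le_compat; apply: Rmult_le_compat_l => //; exact: kappa_ge0. Qed.

(* Where [Phi] solves the equation, it is approximated to first order by the
   exponential with the frozen matrix [sigma s]. *)
Lemma good_step s eps : 0 <= s <= t -> 0 < eps ->
  mderiv_at Phi s (mmul (sigma s) (Phi s)) ->
  exists d, 0 < d /\ forall x y X, 0 <= x -> x <= s -> s <= y -> y <= t ->
    s - d < x -> y < s + d ->
    mdist (Phi y) (mmul (mexp (mscale (y - x) (sigma s))) X) <=
    exp (kappa * (y - x)) * mdist (Phi x) X + Ct * eps * (y - x).
Proof.
move=> st eps0 hd; set A := sigma s.
have Ac : mnorm A <= c by apply: hM; exact: sigmaM.
(* [g] and its derivative vanish at the tag [s], so [g] is at most [eps * |u - s|] nearby. As [s]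
   lies in [[x, y]], the errors at the two ends add up to a multiple of [y - x]. *)
pose g u := madd (Phi u) (mopp (mmul (mexp (mscale (- s + 1 * u) A)) (Phi s))).
have gs : g s = @mzero n.
  by rewrite /g (_ : - s + 1 * s = 0); [rewrite mexp0 mmul1l; mring|ring].
have gd : mderiv_at g s (@mzero n).
  have := mderiv_add hd (mderiv_opp (mderiv_mul
    (mderiv_affine (mderiv_mexp A (- s + 1 * s))) (mderiv_const (Phi s) s))).
  congr mderiv_at; rewrite (_ : - s + 1 * s = 0); last by ring.
  by rewrite mexp0 mmul1r mmul0r mmulZl -/A; mring.
have [d [d0 hd']] := mderiv_zero_small gd gs eps0; exists d; split=> // x y X x0 xs sy yt dx dy.
have gx : mnorm (g x) <= eps * (s - x).
  by have := hd' x; rewrite Rabs_left1; [|lra]; move=> h; have := h ltac:(lra); lra.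
have gy : mnorm (g y) <= eps * (y - s).
  by have := hd' y; rewrite Rabs_pos_eq; [|lra]; apply; lra.
have yx : 0 <= y - x by lra.
set E := mexp (mscale (y - x) A).
have EB : left_bounded (exp (kappa * (y - x))) E by exact: left_bounded_mexp_pos.
have -> : mdist (Phi y) (mmul E X) =
    mnorm (madd (mmul E (madd (Phi x) (mopp X))) (madd (g y) (mopp (mmul E (g x))))).
  rewrite /mdist /g !mmulBr mmulA -mexp_add.
  have -> : y - x + (- s + 1 * x) = - s + 1 * y by ring.
  by congr mnorm; mring.
apply: Rle_trans (mnorm_add _ _) _; apply: Rplus_le_compat; first exact: EB.
apply: Rle_trans (mnorm_add _ _) _; rewrite mnorm_opp.
have h1 : mnorm (mmul E (g x)) <= Ct * (eps * (s - x)).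
  apply: Rle_trans (EB _) _; apply: Rmult_le_compat => //; try exact: mnorm_ge0.
    by apply: Rlt_le; exact: exp_pos.
  by apply: exp_kappa_le; lra.
have h2 : mnorm (g y) <= Ct * (eps * (y - s)).
  apply: Rle_trans gy _; rewrite -{1}(Rmult_1_l (eps * _)).
  apply: Rmult_le_compat_r; first by apply: Rmult_le_pos; lra.
  exact: exp_kappa_ge1.
lra.
Qed.

(** At an exceptional tag the equation gives nothing: the step is charged with the oscillation of
    [Phi] and the displacement [C' * (y - x)] of the exponential. Absolute continuity and the small
    cover make the total charge small. *)
Lemma bad_step s x y X : 0 <= s <= t -> 0 <= x -> x <= y -> y <= t -> exp_St M x X ->
  mdist (Phi y) (mmul (mexp (mscale (y - x) (sigma s))) X) <=
  mdist (Phi x) X + mdist (Phi y) (Phi x) + C' * (y - x).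
Proof.
move=> st x0 xy yt hX; set A := sigma s.
have Ac : mnorm A <= c by apply: hM; exact: sigmaM.
have yx : 0 <= y - x by lra.
set E := mexp (mscale (y - x) A).
have -> : mdist (Phi y) (mmul E X) = mnorm (madd (madd (madd (Phi x) (mopp X))
    (madd (Phi y) (mopp (Phi x)))) (mopp (mmul (madd E (mopp (@mid n))) X))).
  by rewrite /mdist mmulBl mmul1l; congr mnorm; mring.
apply: Rle_trans (mnorm_add _ _) _; apply: Rplus_le_compat; first exact: mnorm_add.
rewrite mnorm_opp; apply: Rle_trans (mnorm_mul _ _) _.
have n0 := pos_INR n; have k0 := kappa_ge0.
have Cp : 0 < Ct := exp_pos _.
have h1 : mnorm (madd E (mopp (@mid n))) <= kappa * Ct * (y - x).
  apply: Rle_trans (mexp_mdist_id c0 Ac yx) _; apply: Rmult_le_compat_r => //.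
  by apply: Rmult_le_compat_l => //; apply: exp_kappa_le; lra.
have h2 : mnorm X <= Ct.
  by apply: Rle_trans (mnorm_exp_St c0 hM hX) _; apply: exp_kappa_le; lra.
have -> : C' * (y - x) = INR n * (kappa * Ct * (y - x)) * Ct by rewrite /C'; ring.
apply: Rmult_le_compat => //; try exact: mnorm_ge0.
  by apply: Rmult_le_pos => //; exact: mnorm_ge0.
exact: Rmult_le_compat_l.
Qed.

Lemma C'_ge0 : 0 <= C'.
Proof.
have k0 := kappa_ge0; have n0 := pos_INR n; have Cp : 0 < Ct := exp_pos _.
by apply: Rmult_le_pos; [apply: Rmult_le_pos => //; apply: Rmult_le_pos|]; lra.
Qed.

(* Exponential products along a partition of [[0, x]] subordinate to a gauge.  The
   intervals [[a' k, b' k]], tagged at exceptional points, lie in the cover. *)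
Definition gauge_state eps (a b : nat -> R) x := exists X m (a' b' : nat -> R) J,
  exp_St M x X /\
  (forall k, (k < m)%N -> 0 <= a' k /\ a' k <= b' k /\ b' k <= x) /\
  (forall k, (k.+1 < m)%N -> b' k <= a' k.+1) /\
  \rsum_(k < m) (b' k - a' k) <= cover_len a b J x /\
  mdist (Phi x) X <= exp (kappa * x) * (Ct * eps * x +
    \rsum_(k < m) mdist (Phi (b' k)) (Phi (a' k)) + C' * (\rsum_(k < m) (b' k - a' k))).

(** The gauge at [s] is the radius from [good_step] where the equation holds, and the distance to
    the ends of a covering interval at an exceptional point. *)
Lemma gauge_state_end eps a b : 0 < eps -> Phi 0 = @mid n ->
  (forall s, (s = 0 \/ s = t) \/ 0 < s < t /\ ~ mderiv_at Phi s (mmul (sigma s) (Phi s)) ->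
    exists k, a k < s < b k) -> gauge_state eps a b t.
Proof.
move=> eps0 P0 cov; apply: gauge_induction => //.
  exists (@mid n), 0%N, (fun=> 0), (fun=> 0), 0%N; split; first exact: exp_St_nil.
  do 2 split=> //; rewrite !big_ord0 P0 mdist_refl.
  by split; [apply: cover_len_ge0; lra|rewrite Rmult_0_r exp_0; lra].
move=> s st.
case: (classic ((s = 0 \/ s = t) \/
    0 < s < t /\ ~ mderiv_at Phi s (mmul (sigma s) (Phi s)))) => [bad|good].
  have [j [aj bj]] := cov s bad; exists (Rmin (s - a j) (b j - s)).
  split; first by apply: Rmin_pos; lra.
  move=> x y x0 xs sy yt dx dy [X [m [a' [b' [J [hX [hab [ord [len err]]]]]]]]].
  have [d1 d2] := (Rmin_l (s - a j) (b j - s), Rmin_r (s - a j) (b j - s)).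
  (* The interval [[x, y]] is stored at index [m], and the cover is widened up to the index [j] of
     the interval containing it. *)
  exists (mmul (mexp (mscale (y - x) (sigma s))) X), m.+1.
  exists (fun k => if (k < m)%N then a' k else x), (fun k => if (k < m)%N then b' k else y).
  exists (maxn J j); split.
    rewrite (_ : y = (y - x) + x); last by ring.
    rewrite (_ : (y - x) + x - x = y - x); last by ring.
    by apply: exp_St_cons => //; [lra|exact: sigmaM].
  split.
    move=> k _; case: ltnP => km; last by lra.
    by have [? [? ?]] := hab k km; lra.
  split.
    move=> k; rewrite ltnS => km; rewrite km; case: ltnP => km'; first exact: ord.
    by have [? [? ?]] := hab k km; lra.
  have sumE (F : R -> R -> R) : \rsum_(k < m.+1) F (if (k < m)%N then b' k else y)
        (if (k < m)%N then a' k else x) = \rsum_(k < m) F (b' k) (a' k) + F y x.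
    rewrite big_ord_recr /= ltnn; congr (_ + _).
    by apply: eq_bigr => k _; rewrite ltn_ord.
  rewrite (sumE (fun b a => b - a)) (sumE (fun b a => mdist (Phi b) (Phi a))).
  have xy : x <= y by lra.
  split.
    apply: Rle_trans (@cover_len_step a b _ j x y (leq_maxr _ _) xy _ _); try lra.
    by have := cover_len_widen a b x0 (leq_maxl J j); lra.
  apply: Rle_trans (bad_step st x0 xy yt hX) _.
  have e1 : exp (kappa * x) <= exp (kappa * y).
    by apply: exp_le_compat; apply: Rmult_le_compat_l => //; exact: kappa_ge0.
  have y0 : 0 <= y by lra.
  have e2 := exp_kappa_ge1 y0.
  set S1 := \rsum_(k < m) mdist _ _ in err *; set S2 := \rsum_(k < m) (_ - _) in err len *.
  have S10 : 0 <= S1 by apply: big_ind => [|u v|k _]; [lra|lra|exact: mdist_ge0].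
  have S20 : 0 <= S2.
    apply: big_ind => [|u v|k _]; [lra|lra|].
    by have [? [? ?]] := hab k (ltn_ord k); lra.
  have C0 := C'_ge0; have Cp : 0 < Ct := exp_pos _.
  have w0 : 0 <= Ct * eps * x + S1 + C' * S2.
    have := Rmult_le_pos _ _ C0 S20.
    have : 0 <= Ct * eps * x by apply: Rmult_le_pos => //; apply: Rmult_le_pos; lra.
    lra.
  have m0 := mdist_ge0 (Phi y) (Phi x).
  have yx : 0 <= y - x by lra.
  have cx := Rmult_le_pos _ _ C0 yx.
  have h1 := Rmult_le_compat_r _ _ _ w0 e1.
  have h2 := Rmult_le_compat_r _ _ _ (Rplus_le_le_0_compat _ _ m0 cx) e2.
  have h3 : 0 <= exp (kappa * y) * (Ct * eps * (y - x)).
    by apply: Rmult_le_pos; [lra|apply: Rmult_le_pos => //; apply: Rmult_le_pos; lra].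
  lra.
have hd : mderiv_at Phi s (mmul (sigma s) (Phi s)).
  apply: NNPP => nd; apply: good.
  case: (Req_dec s 0) => s0; first by left; left.
  case: (Req_dec s t) => s1; first by left; right.
  by right; split=> //; lra.
have [d [d0 step]] := good_step st eps0 hd; exists d; split=> //.
move=> x y x0 xs sy yt dx dy [X [m [a' [b' [J [hX [hab [ord [len err]]]]]]]]].
exists (mmul (mexp (mscale (y - x) (sigma s))) X), m, a', b', J; split.
  rewrite (_ : y = (y - x) + x); last by ring.
  rewrite (_ : (y - x) + x - x = y - x); last by ring.
  by apply: exp_St_cons => //; [lra|exact: sigmaM].
split; first by move=> k /hab[? [? ?]]; lra.
split=> //; split; first by apply: Rle_trans len _; apply: cover_len_mono; lra.
apply: Rle_trans (step x y X x0 xs sy yt dx dy) _.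
have E0 : 0 < exp (kappa * (y - x)) := exp_pos _.
have := Rmult_le_compat_l _ _ _ (Rlt_le _ _ E0) err.
rewrite -Rmult_assoc -exp_plus (_ : kappa * (y - x) + kappa * x = kappa * y); last by ring.
have y0 : 0 <= y by lra.
have Cp : 0 < Ct := exp_pos _.
have w : 0 <= Ct * eps * (y - x) by apply: Rmult_le_pos; [apply: Rmult_le_pos|]; lra.
have := Rmult_le_compat_r _ _ _ w (exp_kappa_ge1 y0); lra.
Qed.

End Approximation.

(** The order of choices is [e1], the tolerance at good tags; [d], from absolute continuity; then a
    cover of length at most [eta], below [d] and small enough for the displacement term. Each of the
    three errors gets [eps / 4]. *)
Lemma cont_St_approx n (M : mat n -> Prop) c t X eps : 0 <= c ->
  (forall A, M A -> mnorm A <= c) -> 0 <= t -> cont_St M t X -> 0 < eps ->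
  exists Y, exp_St M t Y /\ mdist X Y < eps.
Proof.
move=> c0 hM t0 [sigma [Phi [hs [P0 [ac [nul ->]]]]]] eps0.
set kappa := INR n * c; set Ct := exp (kappa * t); set C' := INR n * (kappa * Ct) * Ct.
have Cp : 0 < Ct := exp_pos _.
have C0 : 0 <= C' by exact: C'_ge0.
have CC : 0 < Ct * Ct * (t + 1).
  by apply: Rmult_lt_0_compat; [exact: Rmult_lt_0_compat|lra].
pose e1 := eps / (4 * (Ct * Ct * (t + 1))).
have e10 : 0 < e1 by apply: Rdiv_lt_0_compat; lra.
have e20 : 0 < eps / (4 * Ct) by apply: Rdiv_lt_0_compat; lra.
have [d [d0 hd]] := ac _ e20.
have CC' : 0 < Ct * (C' + 1) by apply: Rmult_lt_0_compat; lra.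
pose eta := Rmin (d / 2) (eps / (4 * (Ct * (C' + 1)))).
have eta0 : 0 < eta by apply: Rmin_pos; [lra|apply: Rdiv_lt_0_compat; lra].
have [a [b [cov [ab len]]]] := null_set_add t (null_set_add 0 nul) eta0.
have [|Y [m [a' [b' [J [hY [hab [ord [lenJ err]]]]]]]]] :=
    @gauge_state_end n M c t sigma Phi c0 hM t0 hs e1 a b e10 P0.
  by move=> s hs'; apply: cov; tauto.
exists Y; split=> //.
set S1 := \rsum_(k < m) mdist _ _ in err; set S2 := \rsum_(k < m) (_ - _) in err lenJ.
have S2e : S2 <= eta.
  by apply: Rle_trans lenJ _; apply: Rle_trans (cover_len_le J t ab) (len J).
have S1e : S1 < eps / (4 * Ct).
  by apply: hd => //; apply: Rle_lt_trans S2e _; have := Rmin_l (d / 2) (eps / (4 * (Ct * (C' + 1)))); rewrite -/eta; lra.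
have h1 : Ct * (Ct * e1 * t) <= eps / 4.
  apply: Rle_trans (_ : (Ct * Ct * (t + 1)) * e1 <= _).
    by have : 0 <= Ct * Ct * e1; [apply: Rmult_le_pos; [apply: Rmult_le_pos|]; lra|lra].
  by apply: Req_le; rewrite /e1; field; split; lra.
have h2 : Ct * S1 < eps / 4.
  by have := Rmult_lt_compat_l _ _ _ Cp S1e; rewrite (_ : Ct * (eps / (4 * Ct)) = eps / 4); [|field; lra].
have h3 : Ct * (C' * S2) <= eps / 4.
  have u : (Ct * (C' + 1)) * eta <= eps / 4.
    apply: Rle_trans (_ : (Ct * (C' + 1)) * (eps / (4 * (Ct * (C' + 1)))) <= _).
      by apply: Rmult_le_compat_l; [lra|exact: Rmin_r].
    by apply: Req_le; field; split; lra.
  have v : Ct * C' * S2 <= Ct * C' * eta.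
    by apply: Rmult_le_compat_l => //; apply: Rmult_le_pos; lra.
  by have := Rmult_lt_0_compat _ _ Cp eta0; lra.
have := err; rewrite -/kappa -/Ct -/C'; lra.
Qed.

(** * The continuous radius *)

(** Both estimates come from [1 + v <= exp v]: at [v = ln (x / y)] it bounds the difference of
    logarithms, at [v = p * (ln y - ln x)] that of powers. *)
Lemma Rpower_lipschitz a b p x y : 0 < a -> 0 <= p -> a <= x <= b -> a <= y <= b ->
  Rabs (Rpower x p - Rpower y p) <= Rpower b p * p / a * Rabs (x - y).
Proof.
move=> a0 p0; wlog yx : x y / y <= x.
  move=> h hx hy; case: (Rle_dec y x) => yx; first exact: h.
  by rewrite Rabs_minus_sym (Rabs_minus_sym x); apply: h => //; lra.
move=> hx hy; rewrite (Rabs_pos_eq (x - y)); last lra.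
have lyx : ln y <= ln x by apply: ln_le_compat; lra.
have mono u v : 0 < u -> u <= v -> Rpower u p <= Rpower v p.
  by move=> u0 uv; apply: exp_le_compat; apply: Rmult_le_compat_l => //; exact: ln_le_compat.
have yxp : Rpower y p <= Rpower x p by apply: mono; lra.
rewrite Rabs_pos_eq; last lra.
have lnle : ln x - ln y <= (x - y) / a.
  have xy0 : 0 < x / y by apply: Rdiv_lt_0_compat; lra.
  have -> : ln x - ln y = ln (x / y) by rewrite /Rdiv ln_mult ?ln_Rinv; try lra; apply: Rinv_0_lt_compat; lra.
  have := exp_ineq1_le (ln (x / y)); rewrite exp_ln // => h.
  apply: Rle_trans (_ : (x - y) / y <= _).
    have : x / y - 1 = (x - y) / y by field; lra.
    lra.
  apply: Rmult_le_compat_l; first lra.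
  by apply: Rinv_le_contravar; lra.
have e : Rpower y p = Rpower x p * exp (p * (ln y - ln x)).
  by rewrite /Rpower -exp_plus; congr exp; ring.
have h := exp_ineq1_le (p * (ln y - ln x)).
have X0 : 0 < Rpower x p := exp_pos _.
apply: Rle_trans (_ : Rpower x p * (p * (ln x - ln y)) <= _).
  rewrite e; have := Rmult_le_compat_l _ _ _ (Rlt_le _ _ X0) h; lra.
have -> : Rpower b p * p / a * (x - y) = Rpower b p * (p * ((x - y) / a)) by rewrite /Rdiv; ring.
apply: Rmult_le_compat; try lra; [|by apply: mono; lra|exact: Rmult_le_compat_l].
by apply: Rmult_le_pos; lra.
Qed.

Lemma Rpower_ge_exp q u b : 0 < q -> Rabs u <= b -> exp (- (Rabs (ln q) * b)) <= Rpower q u.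
Proof.
move=> q0 ub; apply: exp_le_compat.
have := Rle_abs (- (u * ln q)); rewrite Rabs_Ropp Rabs_mult.
by have := Rmult_le_compat_r _ _ _ (Rabs_pos (ln q)) ub; lra.
Qed.

Lemma Rpower_le_exp q u b : 0 < q -> Rabs u <= b -> Rpower q u <= exp (Rabs (ln q) * b).
Proof.
move=> q0 ub; apply: exp_le_compat.
have := Rle_abs (u * ln q); rewrite Rabs_mult.
by have := Rmult_le_compat_r _ _ _ (Rabs_pos (ln q)) ub; lra.
Qed.

Lemma Rpower_lt_base x y p : 0 < p -> 0 < x -> x < y -> Rpower x p < Rpower y p.
Proof.
move=> p0 x0 xy; apply: exp_increasing; apply: Rmult_lt_compat_l => //.
exact: ln_increasing.
Qed.

Section Continuous.
Variables (n : nat) (N : mat n -> Prop) (c t0 : R).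
Hypotheses (c0 : 0 <= c) (hN : forall A, N A -> mnorm A <= c) (Nn : exists A, N A).
Hypothesis t0_gt0 : 0 < t0.

Lemma exp_St_nonempty t : 0 <= t -> exists X, exp_St N t X.
Proof.
by move=> t_ge0; have [A NA] := Nn; exists (mexp (mscale t A)); exact: exp_St_exp.
Qed.

(** By density, a bound on exponential products passes to all Caratheodory solutions, so both sets
    have the same norm supremum. *)
Lemma mnorm_cont_St t X b : 0 <= t -> (forall Y, exp_St N t Y -> mnorm Y <= b) ->
  cont_St N t X -> mnorm X <= b.
Proof.
move=> t_ge0 hb hX; apply: Rnot_lt_le => lt.
have e0 : 0 < mnorm X - b by lra.
have [Y [/hb hY XY]] := cont_St_approx c0 hN t_ge0 hX e0.
by have := mnorm_mdist X Y; lra.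
Qed.

(** Exponentials are invertible, and the inverse of [exp(s A)] has operator bound [exp(n c s)], so
    decay is at most that fast. A smaller rate would give [1 <= C * z ^ k] for all [k] with [z < 1],
    where the [1] is the norm of the identity for [n > 0]. *)
Lemma exp_St_rate_ge rho : (0 < n)%N -> is_rate (exp_St N t0) rho ->
  exp (- (INR n * c * t0)) <= rho.
Proof.
move=> np rt; apply: Rnot_lt_le => lt.
set q0 := exp _ in lt; have q0p : 0 < q0 := exp_pos _.
have [rho0 [up _]] := rt.
pose r := (rho + q0) / 2; have r0 : 0 < r by rewrite /r; lra.
have [|C hC] := up r; first by rewrite /r; lra.
have [A NA] := Nn.
pose z := r * exp (INR n * c * t0).
have Ep : 0 < exp (INR n * c * t0) := exp_pos _.
have z0 : 0 < z by exact: Rmult_lt_0_compat.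
have z1 : z < 1.
  have -> : 1 = q0 * exp (INR n * c * t0) by rewrite /q0 -exp_plus Rplus_opp_l exp_0.
  by apply: Rmult_lt_compat_r => //; rewrite /r; lra.
have Cp := Rabs_pos C.
have iC : 0 < / (Rabs C + 1) by apply: Rinv_0_lt_compat; lra.
have [|k hk] := @pow_lt_1_zero z _ (/ (Rabs C + 1)) iC; first by rewrite Rabs_pos_eq; lra.
have {hk}hk : z ^ k < / (Rabs C + 1).
  by have := hk k (le_n k); rewrite Rabs_pos_eq //; apply: pow_le; lra.
have kt : 0 <= INR k * t0 by apply: Rmult_le_pos; [exact: pos_INR|lra].
have hX := hC k _ ((disc_St_exp_St N k _ (Rlt_le _ _ t0_gt0)).2 (exp_St_exp kt NA)).
have I1 : 1 <= mnorm (@mid n).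
  have := mnorm_entry (@mid n) (Ordinal np) (Ordinal np).
  by rewrite /mid eqxx Rabs_R1.
have := left_bounded_mexp (- (INR k * t0)) c0 (hN NA) (mexp (mscale (INR k * t0) A)).
rewrite mexp_opp_mul Rabs_Ropp Rabs_pos_eq // => h.
have ek : exp (INR n * c * (INR k * t0)) = exp (INR n * c * t0) ^ k.
  by rewrite -Rpower_pow // /Rpower ln_exp; congr exp; ring.
have Ek : 0 < exp (INR n * c * (INR k * t0)) := exp_pos _.
have h2 := Rmult_le_compat_l _ _ _ (Rlt_le _ _ Ek) hX.
have h3 : 1 <= C * z ^ k by rewrite /z Rpow_mult_distr -ek; lra.
have zk : 0 < z ^ k by exact: pow_lt.
have h4 := Rmult_le_compat_r _ _ _ (Rlt_le _ _ zk) (Rle_abs C).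
have h5 : (Rabs C + 1) * z ^ k < 1.
  have C1 : 0 < Rabs C + 1 by lra.
  by have := Rmult_lt_compat_l _ _ _ C1 hk; rewrite Rinv_r; lra.
lra.
Qed.

Lemma time_floor t : 0 <= t -> exists k : nat, INR k * t0 <= t < INR k.+1 * t0.
Proof.
move=> t_ge0; have [|k hk] := @nfloor_ex (t / t0); first by exact: Rdiv_le_0_compat.
exists k; rewrite S_INR; have e : t / t0 * t0 = t by field; lra.
have h1 := Rmult_le_compat_r _ _ _ (Rlt_le _ _ t0_gt0) hk.1.
have h2 := Rmult_lt_compat_r _ _ _ t0_gt0 hk.2.
lra.
Qed.

Lemma sup_norm_cont_St_le t b : 0 <= t -> (forall Y, exp_St N t Y -> mnorm Y <= b) ->
  sup_norm (cont_St N t) <= b.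
Proof.
move=> t_ge0 hb; apply: sup_norm_le => [|X]; last exact: mnorm_cont_St.
by have [X hX] := exp_St_nonempty t_ge0; exists X; exact: exp_St_cont_St.
Qed.

Lemma sup_norm_cont_St_ge t Y : exp_St N t Y -> mnorm Y <= sup_norm (cont_St N t).
Proof.
move=> hY; have t_ge0 := exp_St_ge0 hY.
apply: (@sup_norm_ub _ _ (exp (INR n * c * t))); last exact: exp_St_cont_St.
by move=> X; apply: mnorm_cont_St => // Z; exact: mnorm_exp_St.
Qed.

(** A time between multiples of [t0] differs from one of them by a factor of length at most [t0] and
    norm at most [E]; only constants change, and [root_t_cvg] discards them. *)
Lemma jsr_cont_rate rho : (0 < n)%N -> is_rate (exp_St N t0) rho ->
  jsr_cont N = Rpower rho (/ t0).
Proof.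
move=> np rt; have it0 : 0 < / t0 by exact: Rinv_0_lt_compat.
have rho0 : 0 < rho by apply: Rlt_le_trans (exp_St_rate_ge np rt); exact: exp_pos.
set r := Rpower rho (/ t0); have r0 : 0 < r := exp_pos _.
have rt0 : Rpower r t0 = rho.
  by rewrite /r Rpower_mult Rinv_l ?Rpower_1 //; lra.
have n0 := pos_INR n; have nc : 0 <= INR n * c by exact: Rmult_le_pos.
set E := exp (INR n * c * t0); have E0 : 0 < E := exp_pos _.
have powE q k : 0 < q -> Rpower q t0 ^ k = Rpower q (INR k * t0).
  move=> q0; rewrite -Rpower_pow; last exact: exp_pos.
  by rewrite Rpower_mult Rmult_comm.
have hE t X : 0 <= t -> t <= t0 -> exp_St N t X -> mnorm X <= E.
  move=> t1 t2 hX; apply: Rle_trans (mnorm_exp_St c0 hN hX) _.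
  by apply: exp_le_compat; exact: Rmult_le_compat_l.
have bE X : exp_St N t0 X -> mnorm X <= E by apply: hE; lra.
have cv eps : 0 < eps -> exists T, forall t, T <= t ->
    Rabs (root_t (sup_norm (cont_St N t)) t - r) < eps.
  apply: (@root_t_cvg R id (fun t => sup_norm (cont_St N t))); first lra.
  - move=> t t1; have [|X hX] := @exp_St_nonempty t; first by rewrite /= in t1; lra.
    exact: Rle_trans (mnorm_ge0 X) (sup_norm_cont_St_ge hX).
  - move=> q [q0 qr].
    have q' : 0 < Rpower q t0 < rho.
      by split; [exact: exp_pos|rewrite -rt0; exact: Rpower_lt_base].
    have nE : 0 < (INR n + 1) * (INR n + 1) * E.
      by apply: Rmult_lt_0_compat => //; apply: Rmult_lt_0_compat; lra.
    set D := exp (- (Rabs (ln q) * t0)); have D0 : 0 < D := exp_pos _.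
    exists (D / ((INR n + 1) * (INR n + 1) * E)); split; first exact: Rdiv_lt_0_compat.
    (* For the lower bound a large product of length [(k + 1) * t0], beyond [t], is cut back to [t];
       the upper bound below starts from length [k * t0], at most [t]. *)
    move=> t /= t1; have [|k [k1 k2]] := @time_floor t; first lra.
    have [X [hX qX]] := is_rate_lower (Rlt_le _ _ E0) bE rt (ltn0Sn k) q'.
    have {}hX := (disc_St_exp_St N k.+1 X (Rlt_le _ _ t0_gt0)).1 hX.
    rewrite S_INR in k2.
    have e : INR k.+1 * t0 = t + (INR k.+1 * t0 - t) by ring.
    rewrite e in hX.
    have [||Y [W [hY [hW XE]]]] := exp_St_split _ _ hX; [lra|rewrite S_INR; lra|].
    have hW' : mnorm W <= E by apply: hE hW; rewrite S_INR; lra.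
    have Y0 := mnorm_ge0 Y; have W0 := mnorm_ge0 W.
    apply: Rle_trans (sup_norm_cont_St_ge hY).
    apply: (Rmult_le_reg_l ((INR n + 1) * (INR n + 1) * E)) => //.
    rewrite -Rmult_assoc (_ : _ * (D / _) = D); last by field; lra.
    have h1 : D * Rpower q t <= Rpower q t0 ^ k.+1.
      rewrite powE // e Rpower_plus Rmult_comm; apply: Rmult_le_compat_l.
        by apply: Rlt_le; exact: exp_pos.
      by apply: Rpower_ge_exp => //; rewrite S_INR Rabs_pos_eq; lra.
    apply: Rle_trans h1 _; apply: Rle_trans qX _; rewrite Rmult_assoc Rmult_assoc.
    apply: Rmult_le_compat_l; first lra.
    rewrite XE; apply: Rle_trans (mnorm_mul _ _) _.
    apply: Rle_trans (_ : (INR n + 1) * mnorm Y * E <= _); last by apply: Req_le; ring.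
    apply: Rmult_le_compat => //; first exact: Rmult_le_pos.
    by apply: Rmult_le_compat_r; lra.
  move=> q rq; have q0 : 0 < q by lra.
  have q' : rho < Rpower q t0 by rewrite -rt0; exact: Rpower_lt_base.
  have [C hC] := rt.2.1 _ q'; have Cp := Rabs_pos C.
  exists (INR n * Rabs C * E * exp (Rabs (ln q) * t0)) => t /= t1.
  apply: sup_norm_cont_St_le => [|Y hY]; first lra.
  have [|k [k1 k2]] := @time_floor t; first lra.
  have kt : 0 <= INR k * t0 by apply: Rmult_le_pos; [exact: pos_INR|lra].
  rewrite S_INR in k2.
  have e : t = INR k * t0 + (t - INR k * t0) by ring.
  rewrite e in hY.
  have [||Z [W [hZ [hW ->]]]] := exp_St_split _ _ hY; [lra|lra|].
  have hW' : mnorm W <= E by apply: hE hW; lra.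
  have hZ' := hC k Z ((disc_St_exp_St N k Z (Rlt_le _ _ t0_gt0)).2 hZ).
  have Pq : 0 < Rpower q (INR k * t0) := exp_pos _.
  rewrite powE // in hZ'.
  have Z0 := mnorm_ge0 Z; have W0 := mnorm_ge0 W.
  have hZ2 : mnorm Z <= Rabs C * (exp (Rabs (ln q) * t0) * Rpower q t).
    apply: Rle_trans hZ' _; apply: Rle_trans (_ : Rabs C * Rpower q (INR k * t0) <= _).
      by apply: Rmult_le_compat_r; [lra|exact: Rle_abs].
    apply: Rmult_le_compat_l => //.
    have -> : Rpower q (INR k * t0) = Rpower q (INR k * t0 - t) * Rpower q t.
      by rewrite -Rpower_plus; congr Rpower; ring.
    apply: Rmult_le_compat_r; first by apply: Rlt_le; exact: exp_pos.
    by apply: Rpower_le_exp => //; rewrite Rabs_left1; lra.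
  apply: Rle_trans (mnorm_mul _ _) _.
  apply: Rle_trans (_ : INR n * (Rabs C * (exp (Rabs (ln q) * t0) * Rpower q t)) * E <= _); last first.
    by apply: Req_le; ring.
  apply: Rmult_le_compat => //; first exact: Rmult_le_pos.
  exact: Rmult_le_compat_l.
pose lim x := forall eps, 0 < eps -> exists T, forall t, T <= t ->
  Rabs (root_t (sup_norm (cont_St N t)) t - x) < eps.
have cv' : lim (jsr_cont N) by exact: epsilon_spec (ex_intro lim r cv).
apply: NNPP => ne.
have e0 : 0 < Rabs (jsr_cont N - r) / 2.
  by have := Rabs_pos_lt (jsr_cont N - r); lra.
have [T1 h1] := cv _ e0; have [T2 h2] := cv' _ e0.
have := h1 (Rmax T1 T2) (Rmax_l _ _); have := h2 (Rmax T1 T2) (Rmax_r _ _).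
set x := root_t _ _ => h h'; have := Rabs_triang (jsr_cont N - x) (x - r).
rewrite (Rabs_minus_sym _ x) (_ : jsr_cont N - x + (x - r) = jsr_cont N - r); last by ring.
lra.
Qed.

End Continuous.

Lemma loc_lipschitz_cont n (K : vec n -> Prop) :
  proper_cone K -> loc_lipschitz (P_cont K) (@jsr_cont n).
Proof.
move=> Kp M PM; case: (posnP n) => [n0|np].
  (* All matrices are equal, hence so are all nonempty sets of matrices. *)
  exists 1, 0; do 2 (split; first lra); move=> N1 N2 [_ [_ [[A1 hA1] _]]] [_ [_ [[A2 hA2] _]]] _ _.
  have eqm (A B : mat n) : A = B by apply: mat_ext => i; have := ltn_ord i; rewrite {2}n0.
  have -> : N1 = N2.
    apply: functional_extensionality => A; apply: propositional_extensionality.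
    by rewrite {1}(eqm A A1) (eqm A A2).
  by rewrite /Rminus Rplus_opp_r Rabs_R0; lra.
have [piM [[[c hc] _] [Mn [t0 [t0p [B [MB irr]]]]]]] := PM.
have c0 : 0 <= c by have [A MA] := Mn; apply: Rle_trans (mnorm_ge0 A) (hc A MA).
have c10 : 0 <= c + 1 by lra.
have hc1 A : M A -> mnorm A <= c + 1 by move=> /hc; lra.
have t00 := Rlt_le _ _ t0p; have n0 := pos_INR n.
set kt := INR n * (c + 1) * t0.
have E0 : 0 < exp kt := exp_pos _.
(* The irreducible element lies in the hull of [cont_St M t0], while the sets compared are
   [exp_St N t0]. Their closeness combines [cont_St_approx] for [M] with [exp_St_close] from [M] to
   [N]. *)
have [d [L [dp [L0 hL]]]] := rate_loc_lipschitz Kp MB irr (Rlt_le _ _ E0).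
pose D := INR n * INR n * t0 * exp kt.
have D0 : 0 <= D by rewrite /D; do ! apply: Rmult_le_pos => //; lra.
(* The [1] keeps [N] in the ball of radius [c + 1]; the quotient gives [D * d' <= d / 2], the other
   half of [d] being spent on [cont_St_approx]. *)
pose d' := Rmin 1 (d / (2 * (D + 1))).
have d'0 : 0 < d' by apply: Rmin_pos; [lra|apply: Rdiv_lt_0_compat; lra].
have bE (N : mat n -> Prop) : (forall A, N A -> mnorm A <= c + 1) ->
    forall X, exp_St N t0 X -> mnorm X <= exp kt.
  by move=> hN X hX; exact: (mnorm_exp_St c10 hN hX).
have bound (N : mat n -> Prop) : P_cont K N -> hausdorff M N < d' ->
    (forall A, N A -> mnorm A <= c + 1) /\ close (cont_St M t0) (exp_St N t0) d.
  move=> [_ [[[c' hc'] _] [Nn _]]] H.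
  have [clMN clNM] := hausdorff_close hc hc' Mn Nn H.
  have hN A : N A -> mnorm A <= c + 1.
    move=> NA; have := close_bound hc clNM NA.
    by have := Rmin_l 1 (d / (2 * (D + 1))); rewrite -/d'; lra.
  split=> // X hX; have d2 : 0 < d / 2 by lra.
  have [Y [hY XY]] := cont_St_approx c10 hc1 t00 hX d2.
  have [Z [hZ YZ]] := exp_St_close c10 hc1 hN (Rlt_le _ _ d'0) clMN hY.
  exists Z; split=> //; apply: Rle_lt_trans (mdist_triangle Y _ _) _.
  have : D * d' <= d / 2.
    apply: Rle_trans (_ : (D + 1) * (d / (2 * (D + 1))) <= _).
      by apply: Rmult_le_compat; try lra; exact: Rmin_r.
    by apply: Req_le; field; lra.
  by move: YZ; rewrite -/kt /D; lra.
(* All rates that occur lie in [[q0, R1]], by [exp_St_rate_ge] and [is_rate_le]; there the power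
   [/ t0] is Lipschitz with constant [Lp]. *)
set q0 := exp (- kt); have q0p : 0 < q0 := exp_pos _.
set R1 := INR n * exp kt + 1.
pose Lp := Rpower R1 (/ t0) * / t0 / q0.
have Lp0 : 0 <= Lp.
  apply: Rmult_le_pos; last by apply: Rlt_le; exact: Rinv_0_lt_compat.
  by apply: Rmult_le_pos; apply: Rlt_le; [exact: exp_pos|exact: Rinv_0_lt_compat].
exists d', (Lp * (L * (D + 1))); split=> //; split.
  by apply: Rmult_le_pos => //; apply: Rmult_le_pos => //; lra.
move=> N1 N2 P1 P2 H1 H2.
have [b1 cl1] := bound _ P1 H1; have [b2 cl2] := bound _ P2 H2.
have [pi1 [_ [n1 _]]] := P1; have [pi2 [_ [n2 _]]] := P2.
have [rho1 rt1] := is_rate_exists (Rlt_le _ _ E0) (bE _ b1).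
have [rho2 rt2] := is_rate_exists (Rlt_le _ _ E0) (bE _ b2).
rewrite (jsr_cont_rate c10 b1 n1 t0p np rt1) (jsr_cont_rate c10 b2 n2 t0p np rt2).
have h0 := hausdorff_ge0 b1 b2 n1 n2.
have rlip : Rabs (rho1 - rho2) <= L * (D + 1) * hausdorff N1 N2.
  apply: le_of_forall_gt => [|h hh]; first by apply: Rmult_le_pos; lra.
  have hp : 0 < h by lra.
  have [c12 c21] := hausdorff_close b1 b2 n1 n2 hh.
  have Eclose (N N' : mat n -> Prop) : (forall A, N A -> mnorm A <= c + 1) -> (forall A, N' A -> mnorm A <= c + 1) ->
      close N N' h -> close (exp_St N t0) (exp_St N' t0) ((D + 1) * h).
    move=> bN bN' cl X hX; have [Y [hY XY]] := exp_St_close c10 bN bN' (Rlt_le _ _ hp) cl hX.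
    by exists Y; split=> //; move: XY; rewrite -/kt /D; lra.
  have hp' : 0 <= (D + 1) * h by apply: Rmult_le_pos; lra.
  have u1 := hL _ _ _ _ _ (fun X => exp_St_in_pi pi2) (bE _ b2) cl2 hp' (Eclose _ _ b1 b2 c12) rt1 rt2.
  have u2 := hL _ _ _ _ _ (fun X => exp_St_in_pi pi1) (bE _ b1) cl1 hp' (Eclose _ _ b2 b1 c21) rt2 rt1.
  by apply: Rabs_le; lra.
have rng (N : mat n -> Prop) rho : (exists A, N A) -> (forall A, N A -> mnorm A <= c + 1) ->
    is_rate (exp_St N t0) rho -> q0 <= rho <= R1.
  move=> Nn bN rt; split; first exact: (exp_St_rate_ge c10 bN Nn t0p np rt).
  exact: is_rate_le (Rlt_le _ _ E0) (bE _ bN) rt.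
have it0 : 0 <= / t0 by apply: Rlt_le; exact: Rinv_0_lt_compat.
apply: Rle_trans (Rpower_lipschitz q0p it0 (rng _ _ n1 b1 rt1) (rng _ _ n2 b2 rt2)) _.
by rewrite -/Lp Rmult_assoc; exact: Rmult_le_compat_l.
Qed.

Theorem mainTheorem10 (n : nat) (K : vec n -> Prop) :
  proper_cone K ->
  loc_lipschitz (P_disc K) (@jsr_disc n) /\ loc_lipschitz (P_cont K) (@jsr_cont n).
Proof.
by move=> Kp; split; [exact: loc_lipschitz_disc|exact: loc_lipschitz_cont].
Qed.
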